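(* Let $(V,(\cdot|\cdot))$ be a simple unitary vertex operator algebra and let $\theta$ be the corresponding PCT operator. Then the following are equivalent: (i) $(\cdot|\cdot)$ is the unique normalized invariant scalar product on $V$; (ii) $\mathrm{Aut}_{(\cdot|\cdot)}(V)=\mathrm{Aut}(V)$; (iii) every $g\in\mathrm{Aut}(V)$ commutes with $\theta$; (iv) $\mathrm{Aut}(V)$ is compact; (v) $\mathrm{Aut}_{(\cdot|\cdot)}(V)$ is totally disconnected.
   Context: Vertex algebras are over $\mathbb{C}$ and local (not super). A vertex operator algebra (VOA) $V$ has vacuum vector $\Omega$, vertex operators $Y(a,z)=\sum_{n\in\mathbb{Z}}a_{(n)}z^{-n-1}$, and a conformal vector $\nu$ with $Y(\nu,z)=\sum_{n}L_nz^{-n-2}$, where the $L_n$ satisfy the Virasoro relations, $L_{-1}$ is the infinitesimal translation operator, $L_0$ is diagonalizable, $V=\bigoplus_{n\in\mathbb{Z}}V_n$ with $V_n=\mathrm{Ker}(L_0-n1_V)$, $\dim V_n<\infty$, and $V_n=\{0\}$ for $n$ sufficiently small. $V$ is simple if its only ideals are $\{0\}$ and $V$. A bilinear form on $V$ is invariant if $(Y(a,z)b,c)=(b,Y(e^{zL_1}(-z^{-2})^{L_0}a,z^{-1})c)$ for all $a,b,c\in V$. A scalar product is a positive-definite sesquilinear form (linear in the second variable); it is normalized if $(\Omega|\Omega)=1$. It is invariant if there is a VOA antilinear automorphism $\theta$ of $V$ (an antilinear bijection with $\theta(a_{(n)}b)=\theta(a)_{(n)}\theta(b)$ and $\theta(\nu)=\nu$)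 such that $(\theta\,\cdot\,|\,\cdot)$ is an invariant bilinear form; for a normalized invariant scalar product this $\theta$ is unique and is called the PCT operator. A unitary VOA is a pair $(V,(\cdot|\cdot))$ with $(\cdot|\cdot)$ a normalized invariant scalar product. $\mathrm{Aut}(V)$ is the group of VOA automorphisms: linear bijections $g$ of $V$ with $g(a_{(n)}b)=g(a)_{(n)}g(b)$ for all $a,b\in V$, $n\in\mathbb{Z}$, and $g(\nu)=\nu$. It is given the relative topology as a (closed) subgroup of $\prod_{n\in\mathbb{Z}}\mathrm{GL}(V_n)$ with the product topology. $\mathrm{Aut}_{(\cdot|\cdot)}(V)$ is the topological subgroup of those $g\in\mathrm{Aut}(V)$ with $(ga|gb)=(a|b)$ for all $a,b\in V$. *)

(* Defs.v *)
From HB Require Import structures.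
From mathcomp Require Import all_boot all_order all_algebra.
From mathcomp Require Import complex.
From mathcomp Require Import all_classical all_reals.
From mathcomp Require Import topology.
Set Implicit Arguments.
Unset Strict Implicit.
Unset Printing Implicit Defensive.
Import Order.TTheory GRing.Theory Num.Theory.
Local Open Scope classical_set_scope.
Local Open Scope ring_scope.

(* The field of complex numbers is [R[i]] for [R : realType].
   [Y a n b] is the n-th product a_(n) b, so Y(a,z) = \sum_n (Y a n) z^(-n-1). *)
Record vertexAlgebra (R : realType) := VertexAlgebra {
  va_sort :> lmodType R[i];
  vac : va_sort;
  transl : va_sort -> va_sort;
  Y : va_sort -> int -> va_sort -> va_sort;
  va_transl_linear : linear transl;
  va_linearl : forall n b, linear (fun a => Y a n b);
  va_linearr : forall a n, linear (Y a n);
  va_field : forall a b, exists N : int, forall n, N <= n -> Y a n b = 0;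
  va_transl_vac : transl vac = 0;
  va_vacl : forall n b, Y vac n b = if n == -1 then b else 0;
  va_creation : forall a, Y a (-1) vac = a;
  va_creation0 : forall a n, 0 <= n -> Y a n vac = 0;
  (* [T, Y(a,z)] = d/dz Y(a,z) *)
  va_covariance : forall a n b,
    transl (Y a n b) - Y a n (transl b) = (- n)%:~R *: Y a (n - 1) b;
  (* (z - w)^N [Y(a,z), Y(b,w)] = 0, coefficient of z^(-p-1) w^(-q-1) *)
  va_locality : forall a b, exists N : nat, forall (p q : int) c,
    \sum_(j < N.+1) ((-1) ^+ j * 'C(N, j)%:R) *:
      (Y a (p + N%:Z - j%:Z) (Y b (q + j%:Z) c) -
       Y b (q + j%:Z) (Y a (p + N%:Z - j%:Z) c)) = 0
}.

Definition is_basis (K : pzRingType) (V : lmodType K) (W : set V)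
    (d : nat) (e : 'I_d -> V) : Prop :=
  (forall i, W (e i)) /\
  (forall v, W v -> exists! c : 'cV[K]_d, v = \sum_i c i 0 *: e i).

Definition finite_dim (K : pzRingType) (V : lmodType K) (W : set V) : Prop :=
  exists (d : nat) (e : 'I_d -> V), is_basis W e.

Definition eigen (K : pzRingType) (V : lmodType K) (f : V -> V) (n : int) :
    set V :=
  [set v | f v = n%:~R *: v].

(* The Virasoro modes are L_n = nu_(n+1). The sum V = \bigoplus_n V_n is
   automatically direct, being a sum of eigenspaces of L_0. *)
Record VOA (R : realType) := VOAlgebra {
  voa_va :> vertexAlgebra R;
  nu : voa_va;
  voa_virasoro : exists c : R[i], forall (m n : int) v,
    Y nu (m + 1) (Y nu (n + 1) v) - Y nu (n + 1) (Y nu (m + 1) v) =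
    (m - n)%:~R *: Y nu (m + n + 1) v +
    (if m + n == 0 then c * (m ^+ 3 - m)%:~R / 12 else 0) *: v;
  voa_transl : forall v, Y nu (-1 + 1) v = transl v;
  voa_grading : forall v, exists (s : seq int) (f : int -> voa_va),
    (forall n, eigen (Y nu (0 + 1)) n (f n)) /\ v = \sum_(n <- s) f n;
  voa_bounded_below : exists N : int, forall n, n < N ->
    eigen (Y nu (0 + 1)) n = [set 0];
  voa_finite_dim : forall n, finite_dim (eigen (Y nu (0 + 1)) n)
}.

Definition vir (R : realType) (V : VOA R) (n : int) : V -> V :=
  Y (nu V) (n + 1).

Definition grade (R : realType) (V : VOA R) (n : int) : set V :=
  eigen (vir (V := V) 0) n.

(* A left ideal is two-sided, by skew-symmetry and T-invariance. *)
Definition ideal (R : realType) (V : vertexAlgebra R) (J : set V) : Prop :=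
  [/\ J 0,
      forall (k : R[i]) a b, J a -> J b -> J (k *: a + b),
      forall b, J b -> J (transl b) &
      forall a n b, J b -> J (Y a n b)].

Definition simple (R : realType) (V : VOA R) : Prop :=
  forall J : set V, ideal J -> J = [set 0] \/ J = setT.

(* For a in V_d, [adjoint_mode d a n c] is the coefficient of z^(-n-1) in
     Y(e^(z L_1) (-z^(-2))^(L_0) a, z^(-1)) c
   = (-1)^d \sum_(l, m) z^(l - 2 d + m + 1) / l! (L_1^l a)_(m) c.
   The sum over l has finite support: L_1 lowers the degree by 1 and the
   degrees are bounded below. *)
Definition adjoint_mode (R : realType) (V : VOA R) (d : int) (a : V) (n : int)
    (c : V) : V :=
  ((-1 : R[i]) ^ d) *: \sum_(l \in [set: nat])
    (l`!%:R : R[i])^-1 *: Y (iter l (vir (V := V) 1) a) (2 * d - l%:Z - n - 2) c.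

(* It is enough to state invariance for homogeneous a: they span V and
   (-z^(-2))^(L_0) is defined by linear extension from them. *)
Definition invariant_bilinear (R : realType) (V : VOA R)
    (B : V -> V -> R[i]) : Prop :=
  [/\ forall b, scalar (fun a => B a b),
      forall a, scalar (B a) &
      forall (d : int) (a : V), grade d a -> forall (n : int) (b c : V),
        B (Y a n b) c = B b (adjoint_mode d a n c)].

(* In [R[i]], [0 < x] means that x is real and positive. *)
Definition scalar_product (R : realType) (V : lmodType R[i])
    (ip : V -> V -> R[i]) : Prop :=
  [/\ forall b (k : R[i]) x y, ip (k *: x + y) b = k^* * ip x b + ip y b,
      forall a, scalar (ip a) &
      forall a, a != 0 -> 0 < ip a a].

Definition is_aut (R : realType) (V : VOA R) (g : V -> V) : Prop :=
  [/\ linear g, bijective g,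
      forall a n b, g (Y a n b) = Y (g a) n (g b) &
      g (nu V) = nu V].

Definition is_antilinear_aut (R : realType) (V : VOA R) (g : V -> V) : Prop :=
  [/\ forall (k : R[i]) x y, g (k *: x + y) = k^* *: g x + g y,
      bijective g,
      forall a n b, g (Y a n b) = Y (g a) n (g b) &
      g (nu V) = nu V].

Definition is_PCT (R : realType) (V : VOA R) (ip : V -> V -> R[i])
    (theta : V -> V) : Prop :=
  is_antilinear_aut theta /\ invariant_bilinear (fun a b => ip (theta a) b).

Definition normalized_invariant_scalar_product (R : realType) (V : VOA R)
    (ip : V -> V -> R[i]) : Prop :=
  [/\ scalar_product ip,
      ip (vac V) (vac V) = 1 &
      exists theta, is_PCT ip theta].

Definition aut (R : realType) (V : VOA R) : Type := {g : V -> V | is_aut g}.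

Definition aut_fun (R : realType) (V : VOA R) (g : aut V) : V -> V := sval g.
Coercion aut_fun : aut >-> Funclass.

Definition isometric_aut (R : realType) (V : VOA R) (ip : V -> V -> R[i]) :
    set (aut V) :=
  [set g : aut V | forall a b, ip (g a) (g b) = ip a b].

Definition grade_dim (R : realType) (V : VOA R) (n : int) : nat :=
  projT1 (cid (voa_finite_dim V n)).

Definition grade_basis (R : realType) (V : VOA R) (n : int) :
    'I_(grade_dim V n) -> V :=
  projT1 (cid (projT2 (cid (voa_finite_dim V n)))).

Definition grade_coord (R : realType) (V : VOA R) (n : int) (v : V) :
    'cV[R[i]]_(grade_dim V n) :=
  xget 0 [set c : 'cV[R[i]]_(grade_dim V n) |
    v = \sum_i c i 0 *: @grade_basis R V n i].

(* The family of matrices of the restrictions of g to the spaces V_n in the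
   chosen bases, i.e. the inclusion of Aut(V) in \prod_n GL(V_n). The regular
   module [R[i]^o] carries the topology of the complex numbers. *)
Definition aut_mx (R : realType) (V : VOA R) (g : aut V) :
    prod_topology (fun n : int => 'M[R[i]^o]_(grade_dim V n)) :=
  fun n => \matrix_(i, j) grade_coord n (g (grade_basis j)) i 0.

HB.instance Definition _ (R : realType) (V : VOA R) := gen_eqMixin (aut V).
HB.instance Definition _ (R : realType) (V : VOA R) := gen_choiceMixin (aut V).

(* The relative topology from \prod_n GL(V_n). It does not depend on the bases,
   and GL(V_n) has the subspace topology of the matrices, so taking the
   inverse image from the product of the matrix spaces gives the same. *)
HB.instance Definition _ (R : realType) (V : VOA R) :=
  Topological.copy (aut V) (initial_topology (@aut_mx R V)).

(* Main.v *)
(** In a simple unitary VOA one has V_n = 0 for n < 0 and V_0 = C vac, so an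
    invariant bilinear form is determined by its value on the vacuum. Hence an
    automorphism is isometric iff it commutes with theta, and a second
    invariant scalar product has the form (g a | b) with g a positive
    automorphism.

    If an automorphism g is diagonalizable and chi is a homomorphism from C^*
    to C^*, then letting chi x act on the x-eigenspaces of g is again an
    automorphism, since g (a_(n) b) = (g a)_(n) (g b). For g positive and
    distinct from 1 the characters |x|^(i t) give a nontrivial path of
    isometric automorphisms. For g isometric with an eigenvalue z that is not a
    root of unity, a homomorphism phi from C^* to the additive group of the
    reals with phi z = 1 gives the unbounded family exp (j * phi), so Aut(V) is
    not compact. Thus if Aut(V) is compact then all eigenvalues of isometric
    automorphisms are roots of unity; their traces on V_n are algebraic,
    therefore constant along connected sets, and an isometry of V_n with trace
    dim V_n is the identity. *)
From HB Require Import structures.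
Require Import Defs.
From mathcomp Require Import all_boot all_order all_algebra.
From mathcomp Require Import complex.
From mathcomp Require Import all_classical all_reals.
From mathcomp Require Import topology.
From mathcomp Require Import ring zify.
From mathcomp Require Import normedtype sequences derive exp trigo.
From mathcomp Require Import lebesgue_measure.
Set Implicit Arguments.
Unset Strict Implicit.
Unset Printing Implicit Defensive.
Import Order.TTheory GRing.Theory Num.Theory.
Import numFieldNormedType.Exports.
Local Open Scope classical_set_scope.
Local Open Scope ring_scope.

Section LinearMaps.
Context (K : pzRingType) (U W : lmodType K) (f : U -> W) (fL : linear f).

Let F : {linear U -> W} := HB.pack f (GRing.isLinear.Build K U W *:%R f fL).

Lemma lin0 : f 0 = 0. Proof. exact: (linear0 F). Qed.
Lemma linD u v : f (u + v) = f u + f v. Proof. exact: (linearD F). Qed.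
Lemma linB u v : f (u - v) = f u - f v. Proof. exact: (linearB F). Qed.
Lemma linZ k u : f (k *: u) = k *: f u.
Proof. by have := fL k u 0; rewrite lin0 !addr0. Qed.
Lemma lin_sum I (r : seq I) (P : pred I) (u : I -> U) :
  f (\sum_(i <- r | P i) u i) = \sum_(i <- r | P i) f (u i).
Proof. exact: (linear_sum F). Qed.
End LinearMaps.

(** * Translation-invariant vectors *)

Section VertexAlgebra.
Context (R : realType) (V : vertexAlgebra R).
Implicit Types a b c : V.

Lemma Y0l n b : Y 0 n b = 0 :> V.
Proof. exact: (lin0 (va_linearl n b)). Qed.

Lemma Y0r a n : Y a n 0 = 0 :> V.
Proof. exact: (lin0 (va_linearr a n)). Qed.

Section TranslationInvariant.
Context (a : V) (Ta : transl a = 0).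

(** Translation covariance on the vacuum relates a_(n-1) vac to the translate of a_(n) vac. Starting
    from a_(-1) vac = a, which translation kills, all lower modes vanish by induction; creation
    handles the modes m >= 0. *)
Lemma transl0_mode_vac m : Y a m (vac V) = if m == -1 then a else 0.
Proof.
have neg k : Y a (- (k.+2)%:Z) (vac V) = 0.
  elim: k => [|k IHk].
    have := va_covariance a (-1) (vac V).
    rewrite va_transl_vac Y0r subr0 va_creation Ta opprK scale1r.
    by move=> <-.
  have := va_covariance a (- (k.+2)%:Z) (vac V).
  rewrite va_transl_vac Y0r subr0 IHk (lin0 (@va_transl_linear _ V)) opprK.
  move/esym/eqP; rewrite scaler_eq0 intr_eq0 /= => /eqP.
  by have -> : - (k.+2)%:Z - 1 = - (k.+3)%:Z by lia.
case: eqVneq => [->|m1]; first exact: va_creation.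
case: (lerP 0 m) => m0; first exact: va_creation0.
by have -> : m = - (`|m|.-2.+2)%:Z by lia.
Qed.

(* Locality with Y(a,z) is applied to the vacuum, where Y(a,z) vac = a is
   constant in z while Y(b,w) vac has no pole at w = 0. *)
Lemma mode_transl0 b (n : int) : 0 <= n -> Y b n a = 0.
Proof.
move=> n0; have [N] := va_locality a b.
move=> /(_ (- N%:Z - 1) n (vac V)).
rewrite big_ord_recl /= big1 ?addr0.
  rewrite mul1r bin0 scale1r (va_creation0 b n0) Y0r.
  have -> : - N%:Z - 1 + N%:Z = -1 by ring.
  by rewrite va_creation sub0r => /eqP; rewrite oppr_eq0 => /eqP.
move=> i _.
rewrite (@va_creation0 _ _ b) ?Y0r ?transl0_mode_vac; last by rewrite /bump /=; lia.
by rewrite ifF ?Y0r ?subr0 ?scaler0 //; rewrite /bump /=; apply/eqP; lia.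
Qed.

(** Locality applied to the vacuum with q = -1: the term j = 0 contains b = b_(-1) vac. For j > 0
    the mode b_(j-1) kills both the vacuum and, by [mode_transl0], the vector a. Thus Y(a,z) is
    constant in z. *)
Lemma transl0_mode (m : int) b : m != -1 -> Y a m b = 0.
Proof.
move=> m1; have [N] := va_locality a b.
move=> /(_ (m - N%:Z) (-1) (vac V)).
rewrite big_ord_recl /= mul1r bin0 scale1r subr0.
have -> : m - N%:Z + N%:Z = m by ring.
rewrite va_creation transl0_mode_vac (negbTE m1) Y0r subr0.
rewrite big1 ?addr0 // => i _.
rewrite (@va_creation0 _ _ b) ?Y0r ?transl0_mode_vac; last by rewrite /bump /=; lia.
case: eqP => [im|]; last by rewrite Y0r subr0 scaler0.
by rewrite mode_transl0 ?subr0 ?scaler0 // /bump /=; lia.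
Qed.

(** Taking p = - N - 1 in locality puts a_(-1) in the term j = 0 and vanishing modes of a in all the
    others. *)
Lemma transl0_mode_comm b n c : Y a (-1) (Y b n c) = Y b n (Y a (-1) c).
Proof.
have [N] := va_locality a b.
move=> /(_ (- N%:Z - 1) n c).
rewrite big_ord_recl /= big1 ?addr0 ?subr0.
  have -> : - N%:Z - 1 + N%:Z = -1 by ring.
  by rewrite mul1r bin0 scale1r => /eqP; rewrite subr_eq0 => /eqP.
move=> i _; rewrite !(@transl0_mode (- N%:Z - 1 + N%:Z - (lift ord0 i)%:Z)).
- by rewrite Y0r subr0 scaler0.
- by rewrite /= /bump; lia.
- by rewrite /= /bump; lia.
Qed.

(** Since a_(-1) commutes with all modes and with translation, where covariance only leaves a
    multiple of a_(-2) = 0, its eigenspaces are stable. This feeds a Schur argument for simple V. *)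
Lemma transl0_eigen_ideal (k : R[i]) : ideal [set b : V | Y a (-1) b = k *: b].
Proof.
split=> /=.
- by rewrite Y0r scaler0.
- move=> l b c Hb Hc; rewrite va_linearr Hb Hc scalerDr !scalerA mulrC //.
- move=> b Hb; have := va_covariance a (-1) b.
  rewrite (@transl0_mode (-1 - 1)) // scaler0 Hb (linZ (@va_transl_linear _ V)).
  by move/eqP; rewrite subr_eq0 eq_sym => /eqP.
- by move=> b n c Hc; rewrite transl0_mode_comm Hc (linZ (va_linearr b n)).
Qed.
End TranslationInvariant.
End VertexAlgebra.

(** * Virasoro modes, the grading and the adjoint of L_n *)

Section VOA.
Context (R : realType) (V : VOA R).
Implicit Types a b c : V.

Lemma vir_linear n : linear (vir (V := V) n).
Proof. exact: va_linearr. Qed.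

Lemma vir_vac n : -1 <= n -> vir n (vac V) = 0.
Proof. by move=> n1; apply: va_creation0; lia. Qed.

Lemma vir_comm0 m n v : m + n != 0 ->
  vir m (vir n v) = vir n (vir m v) + (m - n)%:~R *: vir (m + n) v :> V.
Proof.
move=> /negbTE mn; have [c /(_ m n v)] := voa_virasoro V.
by rewrite mn scale0r addr0 => /eqP; rewrite subr_eq => /eqP H; rewrite [RHS]addrC.
Qed.

Lemma grade_vir d n v : grade d v -> grade (d - n) (vir n v : V).
Proof.
rewrite /grade /eigen /= => vd.
have [->|n0] := eqVneq n 0; first by rewrite subr0 vd (linZ (vir_linear _)) vd.
rewrite vir_comm0 !add0r // vd (linZ (vir_linear _)) -scalerDl.
by rewrite -intrD.
Qed.

Lemma vir_m2_vac : vir (-2) (vac V) = nu V.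
Proof. exact: va_creation. Qed.

Lemma grade_nu : grade 2 (nu V).
Proof.
rewrite /grade /eigen /= -vir_m2_vac vir_comm0 // vir_vac //.
by rewrite (lin0 (vir_linear _)) add0r.
Qed.

(** The conformal vector is quasi-primary: it equals L_(-2) vac, and [L_1, L_(-2)] = 3 L_(-1) kills
    the vacuum. Hence only the term l = 0 survives in its adjoint modes. *)
Lemma vir1_nu : vir 1 (nu V) = 0.
Proof.
rewrite -vir_m2_vac vir_comm0 // [vir 1 _]vir_vac // (lin0 (vir_linear _)).
by rewrite add0r vir_vac ?scaler0.
Qed.

Lemma grade_vac : grade 0 (vac V).
Proof. by rewrite /grade /eigen /= vir_vac // scale0r. Qed.

Lemma vir_m1_transl v : vir (-1) v = transl v :> V.
Proof. exact: voa_transl. Qed.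

Lemma vir_1m1 v : vir 1 (vir (-1) v) = vir (-1) (vir 1 v) + 2 *: vir 0 v :> V.
Proof.
have [c /(_ 1 (-1) v)] := voa_virasoro V.
rewrite subrr /= expr1n subrr mulr0 mul0r scale0r addr0.
by move=> /eqP; rewrite subr_eq => /eqP H; rewrite [RHS]addrC.
Qed.

Lemma adjoint_mode_nu n b : adjoint_mode 2 (nu V) (n + 1) b = vir (- n) b.
Proof.
have -> : adjoint_mode 2 (nu V) (n + 1) b = \sum_(l \in [set: nat])
    (l`!%:R : R[i])^-1 *:
      Y (iter l (vir (V := V) 1) (nu V)) (2 * 2 - l%:Z - (n + 1) - 2) b.
  by rewrite /adjoint_mode [X in X *: _]sqrrN expr1n scale1r.
rewrite -(fsbig_widen [set 0%N]) //; last first.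
  move=> [|l] [_] /= l0; first by case: l0.
  rewrite -iterS iterSr vir1_nu.
  have -> : iter l (vir (V := V) 1) 0 = 0.
    by elim: l {l0} => //= l ->; exact: (lin0 (vir_linear _)).
  by rewrite Y0l scaler0.
rewrite fsbig_set1.
by rewrite fact0 invr1 scale1r /vir; congr Y; lia.
Qed.

Lemma invariant_vir (B : V -> V -> R[i]) : invariant_bilinear B ->
  forall n b c, B (vir n b) c = B b (vir (- n) c).
Proof. by move=> [_ _ BY] n b c; rewrite (BY _ _ grade_nu) adjoint_mode_nu. Qed.

Lemma grading_ind (P : V -> Prop) :
  P 0 -> (forall u v, P u -> P v -> P (u + v)) ->
  (forall n v, grade n v -> P v) -> forall v, P v.
Proof.
move=> P0 PD Ph v; have [s [f [fn ->]]] := voa_grading v.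
by apply: big_ind => // n _; apply: Ph (fn n).
Qed.

End VOA.

(** * Graded pieces and scalar products *)

Section Coordinates.
Context (R : realType) (V : VOA R) (n : int).
Local Notation K := R[i].
Local Notation d := (grade_dim V n).
Implicit Types (v : V) (c : 'cV[K]_d).

Definition grade_vec c : V := \sum_i c i 0 *: grade_basis i.

Lemma grade_basisP : is_basis (grade (V := V) n) (@grade_basis R V n).
Proof. exact: projT2 (cid (projT2 (cid (voa_finite_dim V n)))). Qed.

Lemma grade_vec_linear : linear grade_vec.
Proof.
move=> k x y; rewrite /grade_vec scaler_sumr -big_split /=.
by apply: eq_bigr => i _; rewrite !mxE scalerDl scalerA.
Qed.

Lemma grade0 : grade n (0 : V).
Proof. by rewrite /grade /eigen /= (lin0 (vir_linear _)) scaler0. Qed.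

Lemma grade_lin k (u v : V) : grade n u -> grade n v -> grade n (k *: u + v).
Proof.
rewrite /grade /eigen /= => Hu Hv.
by rewrite vir_linear Hu Hv scalerDr !scalerA mulrC.
Qed.

Lemma grade_vecP c : grade n (grade_vec c).
Proof.
have eP i : grade n (@grade_basis R V n i) by exact: grade_basisP.1.
rewrite /grade_vec; apply: big_ind => [|x y gx gy|i _]; first exact: grade0.
  by rewrite -[x]scale1r; exact: grade_lin.
by rewrite -[_ *: _]addr0; apply: grade_lin => //; exact: grade0.
Qed.

Lemma grade_coordK v : grade n v -> grade_vec (grade_coord n v) = v.
Proof.
move=> /(grade_basisP.2) [c [vc _]]; rewrite /grade_coord.
by case: xgetP => [c' _ /= /esym//|/(_ c)] /=.
Qed.

Lemma grade_vecK : cancel grade_vec (grade_coord n).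
Proof.
move=> c; have [c' [_ cU]] := grade_basisP.2 _ (grade_vecP c).
rewrite -[RHS](cU c) //; symmetry; apply: cU; symmetry.
exact/grade_coordK/grade_vecP.
Qed.

Definition op_mx (f : V -> V) : 'M[K]_d :=
  \matrix_(i, j) grade_coord n (f (grade_basis j)) i 0.

Lemma op_vec (f : V -> V) c : linear f ->
  (forall v, grade n v -> grade n (f v)) ->
  f (grade_vec c) = grade_vec (op_mx f *m c).
Proof.
move=> fL fn; have eP i : grade n (@grade_basis R V n i) by exact: grade_basisP.1.
rewrite /grade_vec (lin_sum fL); under eq_bigr do rewrite (linZ fL).
under eq_bigr => i _ do rewrite -(grade_coordK (fn _ (eP i))) /grade_vec scaler_sumr.
rewrite exchange_big /=; apply: eq_bigr => i _.
rewrite mxE scaler_suml; apply: eq_bigr => j _.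
by rewrite mxE scalerA mulrC.
Qed.

Lemma op_mxE (f : V -> V) (M : 'M[K]_d) :
  (forall c, f (grade_vec c) = grade_vec (M *m c)) -> op_mx f = M.
Proof.
move=> fM; apply/matrixP => i j; rewrite mxE.
have -> : grade_basis j = grade_vec (delta_mx j 0).
  rewrite /grade_vec (bigD1 j) //= big1 ?addr0 => [|k kj].
    by rewrite mxE !eqxx scale1r.
  by rewrite mxE (negbTE kj) scale0r.
by rewrite fM grade_vecK -colE mxE.
Qed.

Lemma grade_eigenvector (f : V -> V) v : linear f ->
  (forall v, grade n v -> grade n (f v)) -> grade n v -> v != 0 ->
  exists k w, [/\ grade n w, w != 0 & f w = k *: w].
Proof.
move=> fL fn vn v0; have d0 : (0 < d)%N.
  rewrite lt0n; apply: contraNneq v0 => d0.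
  rewrite -(grade_coordK vn) /grade_vec; move: (grade_coord n v).
  by move: (@grade_basis R V n); rewrite d0 => e c; rewrite big_ord0.
(* [eigenvalueP] yields a row eigenvector, hence the transposes. *)
have [k /eigenvalueP[c cA c0]] := eigenvalue_closed (op_mx f)^T d0.
exists k, (grade_vec c^T); split; first exact: grade_vecP.
  apply: contra_neq c0 => /(congr1 (grade_coord n)).
  rewrite grade_vecK => /(congr1 trmx); rewrite trmxK => ->.
  by rewrite -(lin0 grade_vec_linear) grade_vecK trmx0.
rewrite op_vec // -[op_mx f]trmxK -trmx_mul cA linearZ /=.
by rewrite (linZ grade_vec_linear).
Qed.

End Coordinates.

Section ScalarProduct.
Context (R : realType) (V : lmodType R[i]) (ip : V -> V -> R[i]).
Context (ipS : scalar_product ip).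
Implicit Types (a b x y : V) (k : R[i]).

Lemma ip_linearr a : linear (ip a : V -> R[i]^o). Proof. by case: ipS. Qed.

Lemma ip0r a : ip a 0 = 0. Proof. exact: lin0 (ip_linearr a). Qed.
Lemma ipDr a x y : ip a (x + y) = ip a x + ip a y. Proof. exact: linD (ip_linearr a) _ _. Qed.
Lemma ipZr a k x : ip a (k *: x) = k * ip a x. Proof. exact: linZ (ip_linearr a) _ _. Qed.
Lemma ip_sumr a I (r : seq I) (P : pred I) (u : I -> V) :
  ip a (\sum_(i <- r | P i) u i) = \sum_(i <- r | P i) ip a (u i).
Proof. exact: (lin_sum (ip_linearr a)). Qed.

Lemma ip0l b : ip 0 b = 0.
Proof.
case: ipS => /(_ b 1 0 0); rewrite scaler0 addr0 rmorph1 mul1r => /eqP.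
by rewrite eq_sym addrC -subr_eq0 addrK => /eqP.
Qed.
Lemma ipDl x y b : ip (x + y) b = ip x b + ip y b.
Proof. by case: ipS => /(_ b 1 x y); rewrite scale1r rmorph1 mul1r. Qed.
Lemma ipZl k x b : ip (k *: x) b = k^* * ip x b.
Proof. by case: ipS => /(_ b k x 0); rewrite ip0l !addr0. Qed.

Lemma ip_ge0 a : 0 <= ip a a.
Proof.
have [->|a0] := eqVneq a 0; first by rewrite ip0r.
by case: ipS => _ _ /(_ a a0) /ltW.
Qed.

Lemma ip_eq0 a : ip a a = 0 -> a = 0.
Proof.
move=> aa; apply/eqP; apply: contraT => a0.
by have [_ _ /(_ a a0)] := ipS; rewrite aa ltxx.
Qed.

(** Polarization: positivity makes the diagonal values at a + b and a + 'i b real, which gives the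
    two relations [E1] and [E3]. *)
Lemma ip_conj a b : (ip a b)^* = ip b a.
Proof.
have realip x : (ip x x)^* = ip x x by exact/CrealP/ger0_real/ip_ge0.
have Ha := realip a; have Hb := realip b.
have := realip (a + b); have := realip (a + 'i *: b).
rewrite !ipDl !ipDr !ipZl !ipZr !rmorphD !rmorphM /= conjCK Ha Hb conjCi => Hi H1.
apply: (@mulfI _ 2); first by rewrite pnatr_eq0.
have i2 : 'i * 'i = -1 :> R[i] by rewrite -expr2 sqrCi.
have E1 : (ip a b)^* + (ip b a)^* = ip a b + ip b a.
  by apply: (addrI (ip a a)); apply: (addIr (ip b b)); move: H1; rewrite !addrA.
have E2 : - 'i * (ip a b)^* + 'i * (ip b a)^* = 'i * ip a b - 'i * ip b a.
  apply: (addrI (ip a a)); apply: (addIr ('i * (- 'i * ip b b))).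
  by move: Hi; rewrite !addrA [- 'i * ('i * _)]mulrCA ?mulNr.
have E3 : - (ip a b)^* + (ip b a)^* = ip a b - ip b a.
  apply: (mulfI (neq0Ci R[i])); move: E2; rewrite mulNr => E2.
  by rewrite mulrDr mulrN E2 mulrBr.
have -> : 2 * ip b a = (ip a b + ip b a) - (ip a b - ip b a) by ring.
by rewrite -E1 -E3; ring.
Qed.

Lemma ip_inj x y : (forall a, ip a x = ip a y) -> x = y.
Proof.
move=> H; apply/eqP; rewrite -subr_eq0; apply/eqP/ip_eq0.
by rewrite ipDr -[- y]scaleN1r ipZr H mulN1r subrr.
Qed.

End ScalarProduct.

(** A sum with infinite support is 0 by default. Injectivity of g gives F and its image under g the
    same support, so both sums are read in the same way. *)
Lemma fsum_inj (K : pzRingType) (U W : lmodType K) (g : U -> W) (I : choiceType)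
    (F : I -> U) : linear g -> injective g ->
  g (\sum_(i \in [set: I]) F i) = \sum_(i \in [set: I]) g (F i).
Proof.
move=> gL gI; rewrite (_ : finite_support 0 _ (g \o F) = finite_support 0 setT F).
  by rewrite (lin_sum gL).
rewrite /finite_support (_ : _ `&` (g \o F) @^-1` _ = setT `&` F @^-1` [set~ 0]) //.
apply/seteqP.
split=> i [_ /= Fi]; split=> //= E; apply: Fi; first by rewrite E (lin0 gL).
by apply: gI; rewrite E (lin0 gL).
Qed.

(** * Automorphisms and their action on invariant forms *)

Section Automorphisms.
Context (R : realType) (V : VOA R).
Implicit Types (g h : V -> V) (a b : V).

Lemma vacuum_uniq (u : V) : (forall b, Y u (-1) b = b) -> u = vac V.
Proof. by move=> /(_ (vac V)) <-; rewrite va_creation. Qed.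

Lemma antilinear_lin g h :
  (forall (k : R[i]) x y, g (k *: x + y) = k^* *: g x + g y) ->
  (forall (k : R[i]) x y, h (k *: x + y) = k^* *: h x + h y) ->
  linear (g \o h).
Proof. by move=> gA hA k x y /=; rewrite hA gA conjCK. Qed.

Lemma mode_morph_vac g : bijective g ->
  (forall a n b, g (Y a n b) = Y (g a) n (g b)) -> g (vac V) = vac V.
Proof.
move=> [f gK fK] gY; apply: vacuum_uniq => b.
by rewrite -[b]fK -gY va_vacl.
Qed.

Lemma can_mode_morph g f : cancel f g -> cancel g f ->
  (forall a n b, g (Y a n b) = Y (g a) n (g b)) ->
  forall a n b, f (Y a n b) = Y (f a) n (f b).
Proof. by move=> fK gK gY a n b; rewrite -{1}[a]fK -{1}[b]fK -gY gK. Qed.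

Lemma aut_inv g : is_aut g -> exists f, [/\ is_aut f, cancel f g & cancel g f].
Proof.
move=> [gL [f gK fK] gY gnu]; exists f; split=> //; split.
- by move=> k x y; rewrite -{1}[x]fK -{1}[y]fK -gL gK.
- by exists g.
- exact: can_mode_morph gY.
- by rewrite -gnu gK.
Qed.

Lemma antilinear_aut_inv g : is_antilinear_aut g ->
  exists f, [/\ is_antilinear_aut f, cancel f g & cancel g f].
Proof.
move=> [gA [f gK fK] gY gnu]; exists f; split=> //; split.
- by move=> k x y; rewrite -{1}[x]fK -{1}[y]fK -[k]conjCK -gA gK conjCK.
- by exists g.
- exact: can_mode_morph gY.
- by rewrite -gnu gK.
Qed.

Lemma is_aut_comp g h : is_aut g -> is_aut h -> is_aut (g \o h).
Proof.
move=> [gL gB gY gnu] [hL hB hY hnu]; split.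
- by move=> k x y /=; rewrite hL gL.
- exact: bij_comp.
- by move=> a n b /=; rewrite hY gY.
- by rewrite /= hnu.
Qed.

Lemma aut_vir g n v : is_aut g -> g (vir n v) = vir n (g v).
Proof. by move=> [_ _ gY gnu]; rewrite /vir gY gnu. Qed.

Lemma antilinear_aut_vir g n v : is_antilinear_aut g -> g (vir n v) = vir n (g v).
Proof. by move=> [_ _ gY gnu]; rewrite /vir gY gnu. Qed.

Lemma aut_grade g n v : is_aut g -> grade n v -> grade n (g v).
Proof.
by move=> gA; rewrite /grade /eigen /= -aut_vir // => ->; rewrite linZ //; case: gA.
Qed.

Lemma aut_adjoint_mode g d a n b : is_aut g ->
  g (adjoint_mode d a n b) = adjoint_mode d (g a) n (g b).
Proof.
move=> gA; have [gL gB gY _] := gA.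
rewrite /adjoint_mode (linZ gL); congr (_ *: _).
rewrite fsum_inj //; last exact: bij_inj.
apply: eq_fsbigr => l _; rewrite (linZ gL) gY; congr (_ *: Y _ _ _).
by elim: l => //= l IHl; rewrite aut_vir ?IHl.
Qed.

Lemma invariant_aut (B : V -> V -> R[i]) g : is_aut g ->
  invariant_bilinear B -> invariant_bilinear (fun a b => B (g a) (g b)).
Proof.
move=> gA [Bl Br BY]; have [gL _ gY _] := gA; split.
- by move=> b k x y; rewrite gL Bl.
- by move=> a k x y; rewrite gL Br.
- by move=> d a ad n b c; rewrite gY (BY d) ?aut_adjoint_mode //; exact: aut_grade.
Qed.

End Automorphisms.

(** * Uniqueness of invariant forms *)

Section Unitary.
Context (R : realType) (V : VOA R) (V_simple : simple V).
Context (ip : V -> V -> R[i]) (ipS : scalar_product ip).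
Context (ip1 : ip (vac V) (vac V) = 1).
Context (theta : V -> V) (theta_PCT : is_PCT ip theta).
Implicit Types (a b v : V).

(** The operator [theta] fixes nu, so it commutes with L_n, and invariance of (theta a | b) passes
    to the scalar product itself. *)
Lemma ip_vir n a b : ip (vir n a) b = ip a (vir (- n) b).
Proof.
have [tA /invariant_vir tI] := theta_PCT; have [_ [f tK fK] _ _] := tA.
by rewrite -[a]fK -antilinear_aut_vir // tI.
Qed.

(** From [L_1, L_(-1)] = 2 L_0 and the fact that L_1 is the adjoint of L_(-1). *)
Lemma vir_m1_norm n a : grade n a ->
  ip (vir (-1) a) (vir (-1) a) = ip (vir 1 a) (vir 1 a) + (2 * n)%:~R * ip a a.
Proof.
move=> an; rewrite (ip_vir (-1)) opprK vir_1m1 (ipDr ipS) -(ip_vir 1) (ipZr ipS).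
have -> : vir 0 a = n%:~R *: a by exact: an.
by rewrite (ipZr ipS) mulrA intrM.
Qed.

(** Induction on the height of the degree above the lower bound N: L_1 a has smaller degree and
    vanishes, so [vir_m1_norm] gives L_(-1) a the squared norm 2 n (a | a), which is negative unless
    a = 0. *)
Lemma grade_neg n a : n < 0 -> grade n a -> a = 0.
Proof.
have [N HN] := voa_bounded_below V.
have main k : forall m (b : V), m < 0 -> m < N + k%:Z -> grade m b -> b = 0.
  elim: k => [|k IHk] m b m0 mN bm.
    by have := bm; rewrite /grade HN //; move: mN; rewrite addr0.
  have b1 : vir 1 b = 0 by apply: (IHk (m - 1)); [lia| lia| exact: grade_vir].
  have := vir_m1_norm bm; rewrite b1 (ip0r ipS) add0r => E.
  apply/eqP; apply: contraT => b0; have [_ _ /(_ b b0) bb] := ipS.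
  have := ip_ge0 ipS (vir (-1) b); rewrite E pmulr_lge0 // ler0z; lia.
move=> n0; apply: (main (`|n - N| + 1)%N) => //; lia.
Qed.

Lemma grade0_transl a : grade 0 a -> transl a = 0.
Proof.
move=> a0; rewrite -vir_m1_transl; apply: (ip_eq0 ipS).
rewrite (vir_m1_norm a0) mulr0 mul0r addr0.
by rewrite (@grade_neg (0 - 1) (vir 1 a)) ?(ip0r ipS) //; exact: grade_vir.
Qed.

Lemma vac_neq0 : vac V != 0.
Proof. by apply: contra_eq_neq ip1 => ->; rewrite (ip0r ipS) eq_sym oner_eq0. Qed.

(* Schur: an eigenspace of the mode a_(-1) is a nonzero ideal, so a_(-1) is a
   scalar and a = a_(-1) vac. *)
Lemma grade0_vac a : grade 0 a -> exists k, a = k *: vac V.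
Proof.
move=> a0; have Ta := grade0_transl a0.
have a_grade v : grade 0 v -> grade 0 (Y a (-1) v).
  have E : vir 0 (Y a (-1) v) = Y a (-1) (vir 0 v).
    exact: esym (transl0_mode_comm Ta _ _ _).
  by rewrite /grade /eigen /= E => ->; rewrite (linZ (va_linearr a (-1))).
have [k [w [w0 wN0 aw]]] :=
  grade_eigenvector (va_linearr a (-1)) a_grade (@grade_vac _ V) vac_neq0.
exists k; case: (V_simple (transl0_eigen_ideal Ta k)) => [J0|JT].
  have : [set b | Y a (-1) b = k *: b] w by [].
  by rewrite J0 /= => w00; rewrite w00 eqxx in wN0.
have : [set b | Y a (-1) b = k *: b] (vac V) by rewrite JT.
by rewrite /= va_creation.
Qed.

(** Writing a = a_(-1) vac and moving the mode to the other side reduces B to B(vac, -). This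
    functional vanishes on nonzero degrees, because L_0 is symmetric and kills the vacuum, and V_0
    is spanned by the vacuum. *)
Lemma invariant_bilinear_uniq (B B' : V -> V -> R[i]) :
  invariant_bilinear B -> invariant_bilinear B' ->
  B (vac V) (vac V) = B' (vac V) (vac V) -> B =2 B'.
Proof.
move=> BI BI' B1.
have [Bl Br BY] := BI; have [Bl' Br' BY'] := BI'.
have vacE (C : V -> V -> R[i]) n b : invariant_bilinear C -> grade n b ->
    n != 0 -> C (vac V) b = 0.
  move=> CI bn n0; have := invariant_vir CI 0 (vac V) b.
  have [Cl Cr _] := CI.
  rewrite oppr0 vir_vac // bn (lin0 (Cl b : linear (fun a => C a b : R[i]^o))).
  rewrite (linZ (Cr (vac V) : linear (C (vac V) : V -> R[i]^o))).
  by move/esym/eqP; rewrite mulf_eq0 intr_eq0 (negbTE n0) => /eqP.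
have vacB b : B (vac V) b = B' (vac V) b.
  move: b; apply: grading_ind => [|u v Hu Hv|n v vn].
  - by rewrite (lin0 (Br (vac V) : linear (B (vac V) : V -> R[i]^o)))
               (lin0 (Br' (vac V) : linear (B' (vac V) : V -> R[i]^o))).
  - by rewrite (linD (Br (vac V) : linear (B (vac V) : V -> R[i]^o)))
               (linD (Br' (vac V) : linear (B' (vac V) : V -> R[i]^o))) Hu Hv.
  - have [n0|n0] := eqVneq n 0; last first.
      by rewrite (vacE B n v BI vn n0) (vacE B' n v BI' vn n0).
    move: vn; rewrite n0 => /grade0_vac[k ->].
    by rewrite (linZ (Br (vac V) : linear (B (vac V) : V -> R[i]^o)))
               (linZ (Br' (vac V) : linear (B' (vac V) : V -> R[i]^o))) B1.
move=> a b; move: a; apply: grading_ind => [|u v Hu Hv|n v vn].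
- by rewrite (lin0 (Bl b : linear (fun a => B a b : R[i]^o)))
             (lin0 (Bl' b : linear (fun a => B' a b : R[i]^o))).
- by rewrite (linD (Bl b : linear (fun a => B a b : R[i]^o)))
             (linD (Bl' b : linear (fun a => B' a b : R[i]^o))) Hu Hv.
- by rewrite -[v]va_creation (BY _ _ vn) (BY' _ _ vn) vacB.
Qed.

End Unitary.

(** * Uniqueness, isometry and commutation with the PCT operator *)

Section Equivalences.
Context (R : realType) (V : VOA R) (V_simple : simple V).
Context (ip : V -> V -> R[i]).
Context (ip_unitary : normalized_invariant_scalar_product ip).
Context (theta : V -> V) (theta_PCT : is_PCT ip theta).
Implicit Types (a b v : V).

Let ipS : scalar_product ip. Proof. by case: ip_unitary. Qed.
Let ip1 : ip (vac V) (vac V) = 1. Proof. by case: ip_unitary. Qed.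

Lemma antilinear_aut_vac (f : V -> V) : is_antilinear_aut f -> f (vac V) = vac V.
Proof. by case=> _ fB fY _; exact: mode_morph_vac. Qed.

Lemma aut_vac (f : V -> V) : is_aut f -> f (vac V) = vac V.
Proof. by case=> _ fB fY _; exact: mode_morph_vac. Qed.

Lemma PCT_form_uniq (B : V -> V -> R[i]) : invariant_bilinear B ->
  B (vac V) (vac V) = 1 -> forall a b, B a b = ip (theta a) b.
Proof.
move=> BI B1; have [tA tI] := theta_PCT.
apply: (invariant_bilinear_uniq V_simple ipS ip1 theta_PCT) => //.
by rewrite antilinear_aut_vac // ip1.
Qed.

(** Transport by g keeps the bilinear form invariant and fixes its value on the vacuum. *)
Lemma PCT_form_aut (g : V -> V) a b : is_aut g ->
  ip (theta (g a)) (g b) = ip (theta a) b.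
Proof.
move=> gA; have [tA tI] := theta_PCT.
apply: (PCT_form_uniq (invariant_aut gA tI)).
by rewrite aut_vac // antilinear_aut_vac.
Qed.

Lemma unique_isometric :
  (forall ip' : V -> V -> R[i],
     normalized_invariant_scalar_product ip' -> ip' =2 ip) ->
  isometric_aut ip = [set: aut V].
Proof.
move=> ipU; apply/seteqP; split=> // -[g gA] _ a b /=.
have [f [fA fK gK]] := aut_inv gA.
have [[tA tB tY tnu] tI] := theta_PCT.
have [gL gB gY gnu] := gA; have [fL fB fY fnu] := fA.
apply: (ipU (fun a b => ip (g a) (g b))); split.
- split=> [c k x y|c k x y|c c0].
  + by rewrite gL ipDl // ipZl.
  + by rewrite gL ipDr // ipZr.
  + have [_ _ ip_gt0] := ipS; apply: ip_gt0.
    by apply: contra_neq c0 => gc; rewrite -[c]gK gc (lin0 fL).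
- by rewrite aut_vac.
(* The transported product has the conjugate of [theta] by g as its PCT operator, with [f] the
   inverse of g. *)
- exists (f \o theta \o g); split.
    split=> [k x y|||] /=.
    + by rewrite gL tA fL.
    + by apply: bij_comp => //; exact: bij_comp.
    + by move=> u n v; rewrite gY tY fY.
    + by rewrite gnu tnu fnu.
  rewrite (_ : (fun _ _ => _) = fun a b => ip (theta (g a)) (g b)).
    exact: (invariant_aut gA tI).
  by apply/funext => u; apply/funext => v /=; rewrite fK.
Qed.

(** Both g (theta a) and theta (g a) pair with g c to (theta a | c), and every vector has the form g
    c. *)
Lemma isometric_commute : isometric_aut ip = [set: aut V] ->
  forall (g : aut V) a, g (theta a) = theta (g a).
Proof.
move=> iso g a; have gA : is_aut g := svalP g.
have [f [fA fK gK]] := aut_inv gA.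
have giso u v : ip (g u) (g v) = ip u v.
  by have : [set: aut V] g by []; rewrite -iso; apply.
apply: (ip_inj ipS) => b; rewrite -(ip_conj ipS) -[RHS](ip_conj ipS).
by rewrite -[b]fK giso PCT_form_aut.
Qed.

Lemma commute_isometric :
  (forall (g : aut V) a, g (theta a) = theta (g a)) ->
  forall (g : aut V) a b, ip (g a) (g b) = ip a b.
Proof.
move=> gt g a b; have [[_ [f tK fK] _ _] _] := theta_PCT.
by rewrite -[a]fK gt PCT_form_aut //; exact: svalP.
Qed.

(* The witness is theta theta'^-1, where theta' is the PCT operator of ip'. *)
Lemma positive_aut (ip' : V -> V -> R[i]) :
  normalized_invariant_scalar_product ip' ->
  exists2 g : V -> V, is_aut g & forall a b, ip' a b = ip (g a) b.
Proof.
move=> [ipS' ip1' [t' [t'A t'I]]].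
have [tA tI] := theta_PCT.
have [f [fA fK tK]] := antilinear_aut_inv t'A.
exists (theta \o f).
  have [? ? tY tnu] := tA; have [? ? fY fnu] := fA; split.
  - exact: antilinear_lin.
  - exact: bij_comp.
  - by move=> a n b /=; rewrite fY tY.
  - by rewrite /= fnu.
move=> a b /=; rewrite -{1}[a]fK.
by apply: (PCT_form_uniq t'I); rewrite antilinear_aut_vac.
Qed.

End Equivalences.

(** * Functional calculus of automorphisms *)

(** The hypothesis says that (A - x)^2 and A - x have the same kernel. Repeated roots can then be
    struck from the split minimal polynomial, leaving a product of distinct linear factors that
    annihilates A. *)
Lemma semisimple_diagonalizable (C : numClosedFieldType) n (A : 'M[C]_n) :
  (forall x (v : 'cV[C]_n),
    (A - x%:M) *m ((A - x%:M) *m v) = 0 -> (A - x%:M) *m v = 0) ->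
  exists Q d, Q \in unitmx /\ A = Q *m diag_mx d *m invmx Q.
Proof.
move=> Ass.
have [P Pu [d /(simmxLR Pu) AE]] :
    exists2 P, P \in unitmx & exists d, A ~_P (diag_mx d).
  suff [P Pu /diagonalizable_forPex Pd] : diagonalizable A by exists P.
  case: n A Ass => [|m] A Ass.
    by exists 1%:M; [exact: unitmx1|apply/is_diag_mxP => -[]].
  apply/diagonalizableP.
  have [rs rsE] := closed_field_poly_normal (mxminpoly A).
  move: rsE; rewrite (monicP (mxminpoly_monic A)) scale1r => rsE.
  exists (undup rs); first exact: undup_uniq.
  apply: mxminpoly_min.
  suff ker s (v : 'cV[C]_m.+1) :
      horner_mx A (\prod_(x <- s) ('X - x%:P)) *m v = 0 ->
      horner_mx A (\prod_(x <- undup s) ('X - x%:P)) *m v = 0.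
    apply/matrixP => i j; transitivity
      ((horner_mx A (\prod_(x <- undup rs) ('X - x%:P)) *m
        (delta_mx j 0 : 'cV_m.+1)) i 0).
      by rewrite -colE mxE.
    by rewrite ker ?mxE // -rsE mx_root_minpoly mul0mx.
  have XE x : horner_mx A ('X - x%:P) = A - x%:M.
    by rewrite rmorphB /= horner_mx_X horner_mx_C.
  elim: s v => [//|x s IHs] v; rewrite big_cons /=.
  case: ifP => [xs|_]; last first.
    rewrite big_cons ![('X - x%:P) * _]mulrC !rmorphM /= -!mulmxE -!mulmxA.
    exact: IHs.
  (* A second occurrence of x in s is brought next to the first, and the hypothesis on A merges the
     two. *)
  move=> H; apply: IHs; move: H; rewrite (big_rem x) //=.
  rewrite !rmorphM /= -!mulmxE XE -!mulmxA; exact: Ass.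
exists (invmx P), d; rewrite unitmx_inv invmxK; split=> //.
by rewrite [LHS]AE mxpoly.conjVmx.
Qed.

Section FunctionalCalculus.
Context (K : fieldType) (V : lmodType K).
Implicit Types (f : V -> V) (chi : K -> K) (l : seq (K * V)) (u v : V).

(** Pairs of an eigenvalue and a vector. Eigenvalues may repeat and vectors may be 0, so such lists
    can be concatenated and rescaled freely. *)
Definition eigenlist f l := {in l, forall p, f p.2 = p.1 *: p.2}.

Definition spanned_by_eigenvectors f :=
  forall v, exists2 l, eigenlist f l & v = \sum_(p <- l) p.2.

(* The linear map acting on the x-eigenspace of f as the scalar chi x. *)
Definition fcalc f chi v : V :=
  \sum_(p <- xget [::] [set l | eigenlist f l /\ v = \sum_(p <- l) p.2])
    chi p.1 *: p.2.

Lemma interpolation (s : seq K) chi : exists p : {poly K},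
  {in s, forall x, p.[x] = chi x}.
Proof.
elim: s => [|x s [p pE]]; first by exists 0.
have [xs|xs] := boolP (x \in s).
  by exists p => y; rewrite inE => /predU1P[->|]; exact: pE.
pose q := \prod_(y <- s) ('X - y%:P).
have qx : q.[x] != 0.
  by apply: contra xs => /eqP qx; rewrite -root_prod_XsubC; apply/rootP.
(* Newton's step: the correction vanishes at the earlier nodes. *)
exists (p + ((chi x - p.[x]) / q.[x]) *: q) => y.
rewrite inE hornerD hornerZ => /predU1P[->|ys]; first by rewrite divfK // subrKC.
have /rootP -> : root q y by rewrite root_prod_XsubC.
by rewrite mulr0 addr0 pE.
Qed.

(** On the finitely many eigenvalues listed, chi agrees with a polynomial q, and the sum is q(f)
    applied to 0. This makes [fcalc] independent of the chosen decomposition. *)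
Lemma eigen_sum0 f chi l : linear f -> eigenlist f l ->
  \sum_(p <- l) p.2 = 0 -> \sum_(p <- l) chi p.1 *: p.2 = 0.
Proof.
move=> fL fl l0; have [q qE] := interpolation (map fst l) chi.
rewrite (_ : \sum_(p <- l) _ = \sum_(p <- l) q.[p.1] *: p.2); last first.
  by apply: eq_big_seq => p pl; rewrite qE // map_f.
move=> {qE}; elim/poly_ind: q => [|q c IHq].
  by rewrite big1 // => p _; rewrite horner0 scale0r.
have := congr1 f IHq; rewrite (lin_sum fL) (lin0 fL) => H.
rewrite (_ : \sum_(p <- l) _ =
    \sum_(p <- l) f (q.[p.1] *: p.2) + c *: \sum_(p <- l) p.2).
  by rewrite H l0 scaler0 addr0.
rewrite scaler_sumr -big_split /=; apply: eq_big_seq => p pl.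
by rewrite !hornerE scalerDl (linZ fL) fl // scalerA.
Qed.

Section Calculus.
Context (f : V -> V) (fL : linear f).

Lemma eigenlist_cat l1 l2 :
  eigenlist f l1 -> eigenlist f l2 -> eigenlist f (l1 ++ l2).
Proof. by move=> f1 f2 p; rewrite mem_cat => /orP[/f1|/f2]. Qed.

Lemma eigenlist_scale (c : K -> K) l :
  eigenlist f l -> eigenlist f [seq (p.1, c p.1 *: p.2) | p <- l].
Proof.
move=> fl p /mapP[q ql ->] /=; rewrite (linZ fL) fl // !scalerA mulrC //.
Qed.

Lemma fcalcE chi l : eigenlist f l ->
  fcalc f chi (\sum_(p <- l) p.2) = \sum_(p <- l) chi p.1 *: p.2.
Proof.
move=> fl; rewrite /fcalc; case: xgetP => [m _ [fm mE]|/(_ l)]; last by case.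
(* The decomposition picked by [xget] followed by the negative of l is an eigenlist with sum 0. *)
have := eigen_sum0 chi fL (eigenlist_cat fm (eigenlist_scale (c := fun=> -1) fl)).
rewrite !big_cat !big_map /= -scaler_sumr -mE scaleN1r subrr.
under [X in _ + X]eq_bigr do rewrite scaleN1r scalerN.
by rewrite sumrN => /(_ erefl)/eqP; rewrite subr_eq0 => /eqP.
Qed.

Lemma fcalc_eigen chi x u : f u = x *: u -> fcalc f chi u = chi x *: u.
Proof.
move=> fu; have := @fcalcE chi [:: (x, u)]; rewrite !big_seq1; apply.
by move=> p; rewrite inE => /eqP ->.
Qed.

Context (fS : spanned_by_eigenvectors f).

Lemma fcalc_linear chi : linear (fcalc f chi).
Proof.
move=> k u v; have [l fl ->] := fS u; have [m fm ->] := fS v.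
rewrite scaler_sumr (fcalcE _ fl) (fcalcE _ fm) scaler_sumr.
have := fcalcE chi (eigenlist_cat (eigenlist_scale (c := fun=> k) fl) fm).
rewrite !big_cat !big_map /= => ->; congr (_ + _).
by apply: eq_bigr => p _; rewrite !scalerA mulrC.
Qed.

Lemma fcalc_comp chi1 chi2 u :
  fcalc f chi1 (fcalc f chi2 u) = fcalc f (fun x => chi1 x * chi2 x) u.
Proof.
have [l fl ->] := fS u; rewrite !(fcalcE _ fl).
have := fcalcE chi1 (eigenlist_scale (c := chi2) fl); rewrite !big_map /= => ->.
by apply: eq_bigr => p _; rewrite scalerA.
Qed.

(** Injectivity of f forces the vectors listed with eigenvalue 0 to vanish, so the value of chi at 0
    does not enter. *)
Lemma fcalc_id chi u : injective f -> (forall x, x != 0 -> chi x = 1) ->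
  fcalc f chi u = u.
Proof.
move=> fI chi1; have [l fl ->] := fS u; rewrite (fcalcE _ fl).
apply: eq_big_seq => p pl; have [p0|p0] := eqVneq p.1 0.
  have -> : p.2 = 0 by apply: fI; rewrite fl // p0 scale0r (lin0 fL).
  by rewrite scaler0.
by rewrite chi1 // scale1r.
Qed.

End Calculus.
End FunctionalCalculus.

Section AutCalculus.
Context (R : realType) (V : VOA R) (g : V -> V) (gA : is_aut g).
Context (gS : spanned_by_eigenvectors g).

Lemma fcalc_aut (chi : R[i] -> R[i]) : chi 1 = 1 ->
  (forall x y, x != 0 -> y != 0 -> chi (x * y) = chi x * chi y) ->
  is_aut (fcalc g chi).
Proof.
have [gL gB gY gnu] := gA; move=> chi1 chiM.
have chiV x : x != 0 -> chi x * (chi x)^-1 = 1.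
  move=> x0; apply: divff; apply: contra_neq (oner_neq0 R[i]) => cx0.
  by rewrite -chi1 -(divff x0) chiM ?invr_eq0 // cx0 mul0r.
split; first exact: fcalc_linear.
- exists (fcalc g (fun x => (chi x)^-1)) => u; rewrite fcalc_comp //.
    by apply: (fcalc_id gL gS _ (bij_inj gB)) => x x0; rewrite mulrC chiV.
  by apply: (fcalc_id gL gS _ (bij_inj gB)) => x x0; rewrite chiV.
- move=> a n b; have [l gl ->] := gS a; have [m gm ->] := gS b.
  rewrite !(fcalcE _ _ gl) // !(fcalcE _ _ gm) //.
  rewrite !(lin_sum (va_linearr _ n)).
  under eq_bigr do rewrite (lin_sum (va_linearl n _)).
  under [RHS]eq_bigr do rewrite (lin_sum (va_linearl n _)).
  rewrite exchange_big [RHS]exchange_big /=.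
  (* The products a_(n) b of eigenvectors for x and y are eigenvectors for x y. *)
  pose lm := [seq (p.1 * q.1, Y p.2 n q.2) | p <- l, q <- m].
  have glm : eigenlist g lm.
    move=> _ /allpairsP[[p q] [/= pl qm ->]] /=.
    by rewrite gY gl // gm // (linZ (va_linearl n _)) (linZ (va_linearr _ n)) scalerA.
  have := fcalcE gL chi glm; rewrite !big_allpairs_dep /= => ->.
  have g0 p l' : eigenlist g l' -> p \in l' -> p.1 = 0 -> p.2 = 0.
    move=> gl' pl' p0; apply: (bij_inj gB).
    by rewrite gl' // p0 scale0r (lin0 gL).
  apply: eq_big_seq => p pl; apply: eq_big_seq => q qm.
  rewrite (linZ (va_linearl n _)) (linZ (va_linearr _ n)) scalerA.
  have [/(g0 _ _ gl pl) ->|p0] := eqVneq p.1 0; first by rewrite Y0l !scaler0.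
  have [/(g0 _ _ gm qm) ->|q0] := eqVneq q.1 0; first by rewrite Y0r !scaler0.
  by rewrite chiM.
- by rewrite (fcalc_eigen gL chi (x := 1)) ?chi1 ?scale1r.
Qed.

End AutCalculus.

(** * Compactness of isometry groups *)

Section Topology.
Context (R : realType) (V : VOA R).
Local Notation K := R[i].

(** The topology is initial for [aut_mx], with values in a product of matrix spaces, so convergence
    can be tested entry by entry. *)
Lemma aut_cvg (F : set_system (aut V)) (g : aut V) : Filter F ->
  (forall n i j,
     (fun h : aut V => aut_mx h n i j : K^o) @ F --> (aut_mx g n i j : K^o)) ->
  F --> g.
Proof.
move=> FF Fg; have FM : @aut_mx R V @ F --> aut_mx g.
  apply/cvg_sup => n A /= [_ [[C Co <-] Cg] CA].
  apply: filterS CA _.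
  have [P Pg PC] : nbhs (aut_mx g n) C by exact: open_nbhs_nbhs.
  rewrite /= in Pg.
  apply: (@filterS _ F _
    [set h : aut V | forall i j, P i j (aut_mx h n i j)]) => [h Ph|].
    exact: PC.
  apply: filter_forall => i; apply: filter_forall => j.
  exact: Fg (Pg i j).
move=> A [B [[C Co CB] Bg BA]]; apply: filterS BA _.
rewrite -CB; apply: FM; apply: open_nbhs_nbhs; split=> //.
by move: Bg; rewrite -CB.
Qed.

Lemma aut_mx_continuous n i j : continuous (fun g : aut V => aut_mx g n i j : K^o).
Proof.
move=> g; apply: (@continuous_comp _ _ _
  (fun g : aut V => aut_mx g n : 'M[K^o]_(grade_dim V n)) (fun M => M i j)).
  apply: (@continuous_comp _ _ _ (@aut_mx R V) (fun f => f n)).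
    exact: initial_continuous.
  exact: (@proj_continuous _ (fun n : int => 'M[K^o]_(grade_dim V n)) n).
exact: coord_continuous.
Qed.

End Topology.

Section ComplexTopology.
Context (R : realType).
Local Notation K := R[i].

Lemma cvg_complex T (F : set_system T) (f : T -> K) (z : K) : Filter F ->
  (fun t => complex.Re (f t)) @ F --> complex.Re z ->
  (fun t => complex.Im (f t)) @ F --> complex.Im z ->
  (f : T -> K^o) @ F --> (z : K^o).
Proof.
move=> FF fr fi; apply/cvgrPdist_lt => e e0.
have er : e = (complex.Re e)%:C%C by rewrite RRe_real // gtr0_real.
have r0 : 0 < complex.Re e / 2 by apply: divr_gt0 => //; move: e0; rewrite er ltcR.
move/cvgrPdist_lt/(_ _ r0) in fr; move/cvgrPdist_lt/(_ _ r0) in fi.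
near=> t.
have h1 : `|complex.Re z - complex.Re (f t)| < complex.Re e / 2 by near: t.
have h2 : `|complex.Im z - complex.Im (f t)| < complex.Re e / 2 by near: t.
rewrite er normc_def ltcR.
apply: le_lt_trans (_ : _ <= `|complex.Re (z - f t)| + `|complex.Im (z - f t)|) _.
  rewrite -[leRHS]ger0_norm ?addr_ge0 // -sqrtr_sqr ler_wsqrtr //.
  by rewrite sqrrD !real_normK ?num_real // addrAC lerDl mulrn_wge0 // mulr_ge0.
rewrite (_ : complex.Re e = complex.Re e / 2 + complex.Re e / 2); last by field.
by rewrite !raddfB; exact: ltrD.
Unshelve. all: by end_near.
Qed.

Lemma Re_continuous : continuous (fun z : K^o => complex.Re z).
Proof.
move=> z; have FF : Filter (nbhs (z : K^o)) by exact: nbhs_filter.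
apply/(@cvgrPdist_lt _ _ _ _ FF) => e e0.
have : (fun w : K^o => w) @ z --> z by exact: cvg_id.
move=> /cvgrPdist_lt/(_ e%:C%C); rewrite ltcR => /(_ e0).
apply: filterS => w; rewrite normc_def ltcR; apply: le_lt_trans.
rewrite -raddfB -sqrtr_sqr ler_wsqrtr // lerDl sqr_ge0 //.
Qed.

Lemma compact_disc (r : R) : exists2 A : set K^o, compact A &
  forall z : K, `|z| <= r%:C%C -> A z.
Proof.
(* The closed square of half-side r, a continuous image of a product of two segments. *)
exists [set ((ab.1 +i* ab.2)%C : K^o) | ab in `[(- r), r] `*` `[(- r), r]].
  apply: continuous_compact.
    apply: continuous_subspaceT => ab.
    by apply: cvg_complex => /=; [exact: cvg_fst|exact: cvg_snd].
  by apply: compact_setX; exact: segment_compact.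
move=> [a b]; rewrite normc_def lecR /= => abr.
exists (a, b) => //; split; rewrite /= in_itv /= -ler_norml.
  by apply: le_trans abr; rewrite -sqrtr_sqr ler_wsqrtr // lerDl sqr_ge0.
by apply: le_trans abr; rewrite -sqrtr_sqr ler_wsqrtr // lerDr sqr_ge0.
Qed.

End ComplexTopology.

Section ScalarLimits.
Context (K : numFieldType) (T : Type) (F : set_system T) (FF : Filter F).

Definition tends (f : T -> K) (z : K) := (f : T -> K^o) @ F --> (z : K^o).

Lemma tends_cst z : tends (fun=> z) z. Proof. exact: cvg_cst. Qed.

Lemma tendsD f g a b : tends f a -> tends g b -> tends (fun t => f t + g t) (a + b).
Proof. by move=> fa gb; exact: (@cvgD K K^o _ _ _ f g). Qed.

Lemma tendsM f g a b : tends f a -> tends g b -> tends (fun t => f t * g t) (a * b).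
Proof. by move=> fa gb; exact: (@cvgM K _ _ _ f g). Qed.

Lemma tends_sum I (r : seq I) (P : pred I) (f : I -> T -> K) a :
  (forall i, P i -> tends (f i) (a i)) ->
  tends (fun t => \sum_(i <- r | P i) f i t) (\sum_(i <- r | P i) a i).
Proof.
move=> fa; elim: r => [|i r IHr].
  by rewrite big_nil; under eq_fun do rewrite big_nil; exact: tends_cst.
rewrite big_cons; under eq_fun do rewrite big_cons.
by case: ifP => // Pi; apply: tendsD => //; exact: fa.
Qed.

End ScalarLimits.

Lemma tends_uniq (K : numFieldType) T (F : set_system T) (f : T -> K) a b :
  ProperFilter F -> tends F f a -> tends F f b -> a = b.
Proof.
move=> FF fa fb.
exact: (@cvg_unique K^o (@norm_hausdorff _ K^o) (fmap f F) _ a b).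
Qed.

Lemma tends_conj (C : numClosedFieldType) T (F : set_system T) (f : T -> C) a :
  Filter F -> tends F f a -> tends F (fun t => (f t)^*) a^*.
Proof.
move=> FF fa; apply/(@cvgrPdist_lt C C^o) => e e0.
move/(@cvgrPdist_lt C C^o): fa => /(_ e e0).
by apply: filterS => t; rewrite -rmorphB norm_conjC.
Qed.

(** The image ultrafilter lives on a compact set, hence has a cluster point, and an ultrafilter
    converges to each of its cluster points. *)
Lemma ultra_tends (R : realType) T (F : set_system T) (f : T -> R[i]) (r : R[i]) :
  UltraFilter F -> r \is Num.real -> (forall t, `|f t| <= r) -> exists z, tends F f z.
Proof.
move=> FU rr fr; have [A Acpt rA] := compact_disc (complex.Re r).
have FA : (f @ F) A.
  apply: (@filterS _ F _ setT) filterT => t _; apply: rA.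
  by rewrite RRe_real.
have [z [Az zF]] := Acpt (f @ F : set_system R[i]^o) _ FA.
exists z => B zB.
have [//|FnB] := in_ultra_setVsetC (f @^-1` B) FU.
by have [w [nBw Bw]] := zF (~` B) B FnB zB.
Qed.

(** * Limits of isometric automorphisms along an ultrafilter *)

Section IsometricLimit.
Context (R : realType) (V : VOA R) (ip : V -> V -> R[i]).
Context (ipS : scalar_product ip).
Local Notation K := R[i].

(** A weak Cauchy-Schwarz bound, enough to bound the matrix coefficients of isometries uniformly. *)
Lemma ip_le x y : `|ip x y| <= ip x x + ip y y.
Proof.
have [->|p0] := eqVneq (ip x y) 0; first by rewrite normr0 addr_ge0 // ip_ge0.
set p := ip x y in p0 *; have n0 : `|p| != 0 by rewrite normr_eq0.
(* A phase with k p = |p|, so that the squared norm of x - k y is (x | x) + (y | y) - 2 |p|. *)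
pose k := p^* / `|p|.
have kp : k * p = `|p|.
  by rewrite /k mulrAC -normCKC expr2 mulfK.
have kp' : k^* * p^* = `|p| by rewrite -rmorphM kp; apply/CrealP; exact: normr_real.
have kk : k^* * k = 1.
  by rewrite -normCKC /k normf_div norm_conjC normr_id divff ?expr1n.
have := ip_ge0 ipS (x - k *: y).
rewrite -scaleNr (ipDl ipS) !(ipDr ipS) !(ipZl ipS) !(ipZr ipS) -(ip_conj ipS x y) -/p.
rewrite rmorphN mulrA mulrNN kk mul1r !mulNr kp kp' => H.
rewrite -subr_ge0 (_ : _ - `|p| =
  ip x x - `|p| + (- `|p| + ip y y) + `|p|); last by ring.
exact: addr_ge0.
Qed.

Definition gram n : 'M[K]_(grade_dim V n) :=
  \matrix_(i, j) ip (grade_basis i) (grade_basis j).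

Lemma gramE n c : gram n *m c = \col_i ip (grade_basis i) (grade_vec c).
Proof.
apply/colP => i; rewrite !mxE /grade_vec (ip_sumr ipS).
by apply: eq_bigr => j _; rewrite (ipZr ipS) mxE mulrC.
Qed.

(** A vector in the kernel is orthogonal to a basis, hence to itself. Inverting [gram] recovers
    coordinates from scalar products with the basis. *)
Lemma gram_unit n : gram n \in unitmx.
Proof.
rewrite -unitmx_tr -row_free_unit -kermx_eq0; apply/rowV0P => v /sub_kermxP v0.
have g0 : gram n *m v^T = 0 by rewrite -[gram n]trmxK -trmx_mul v0 trmx0.
apply: (can_inj (@trmxK _ _ _)); rewrite trmx0 -[v^T]grade_vecK.
suff -> : grade_vec v^T = 0 by rewrite -(lin0 (@grade_vec_linear _ _ n)) grade_vecK.
apply: (ip_eq0 ipS).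
rewrite {1}/grade_vec; apply/(can_inj conjCK); rewrite (ip_conj ipS) (ip_sumr ipS).
rewrite rmorph0 big1 // => i _.
rewrite (ipZr ipS) -(ip_conj ipS).
by move/colP/(_ i): g0; rewrite gramE !mxE => ->; rewrite rmorph0 mulr0.
Qed.

Context (T : Type) (F : set_system T) (FU : UltraFilter F) (H : T -> V -> V).
Context (HA : forall t, is_aut (H t)).
Context (Hip : forall t a b, ip (H t a) (H t b) = ip a b).

(** The scalar products of H t v with the basis are bounded because H t is isometric, so they
    converge along the ultrafilter; the inverse Gram matrix turns their limits into limits of
    coordinates. *)
Lemma coord_lim n v : grade n v -> exists c : 'cV[K]_(grade_dim V n),
  forall i, tends F (fun t => grade_coord n (H t v) i 0) (c i 0).
Proof.
move=> vn.
have /choice[y Hy] : forall i : 'I_(grade_dim V n), exists z,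
    tends F (fun t => ip (grade_basis i) (H t v)) z.
  move=> i.
  apply: (@ultra_tends _ _ _ _ (ip (grade_basis i) (grade_basis i) + ip v v)) => [|t].
    by rewrite ger0_real // addr_ge0 // ip_ge0.
  by rewrite -(Hip t v v); exact: ip_le.
exists (invmx (gram n) *m (\col_i y i)) => i.
rewrite mxE; under eq_fun => t.
  rewrite -[grade_coord n _](mulKmx (gram_unit n)) gramE.
  rewrite (grade_coordK (aut_grade (HA t) vn)) mxE.
  over.
apply: tends_sum => j _; apply: tendsM; first exact: tends_cst.
by rewrite mxE; under eq_fun do rewrite mxE; exact: Hy.
Qed.

Lemma coord_tends_ip n v (c : 'cV_(grade_dim V n)) x : grade n v ->
  (forall i, tends F (fun t => grade_coord n (H t v) i 0) (c i 0)) ->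
  tends F (fun t => ip x (H t v)) (ip x (grade_vec c)).
Proof.
move=> vn Hc; rewrite /grade_vec (ip_sumr ipS).
under eq_fun => t.
  rewrite -(grade_coordK (aut_grade (HA t) vn)) /grade_vec (ip_sumr ipS).
  over.
apply: tends_sum => i _; rewrite (ipZr ipS).
under eq_fun do rewrite (ipZr ipS).
by apply: tendsM; [exact: Hc|exact: tends_cst].
Qed.

Lemma lim_ex v : exists w, forall x, tends F (fun t => ip x (H t v)) (ip x w).
Proof.
move: v; apply: grading_ind => [|u v [w Hw] [w' Hw']|n v vn].
- exists 0 => x; under eq_fun => t.
    rewrite (lin0 (_ : linear (H t))); last by case: (HA t).
    over.
  exact: tends_cst.
- exists (w + w') => x; under eq_fun => t.
    rewrite (linD (_ : linear (H t))) ?(ipDr ipS); last by case: (HA t).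
    over.
  by rewrite (ipDr ipS); apply: tendsD.
- have [c Hc] := coord_lim vn; exists (grade_vec c) => x.
  exact: coord_tends_ip.
Qed.

Context (g : V -> V) (Hg : forall v x, tends F (fun t => ip x (H t v)) (ip x (g v))).

Lemma lim_uniq v w : (forall x, tends F (fun t => ip x (H t v)) (ip x w)) -> g v = w.
Proof.
move=> Hw; apply: (ip_inj ipS) => x.
exact: (tends_uniq ultra_proper (@Hg v x) (Hw x)).
Qed.

(** In finite dimension the weak limit is also a limit of coordinates. This is what allows limits in
    expressions where two arguments vary with t. *)
Lemma lim_coord n v : grade n v -> grade n (g v) /\
  forall i, tends F (fun t => grade_coord n (H t v) i 0) (grade_coord n (g v) i 0).
Proof.
move=> vn; have [c Hc] := coord_lim vn.
have -> : g v = grade_vec c by apply: lim_uniq => x; exact: coord_tends_ip.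
by split; [exact: grade_vecP|rewrite grade_vecK].
Qed.

Lemma lim_linear : linear g.
Proof.
move=> k u v; apply: lim_uniq => x; rewrite (ipDr ipS) (ipZr ipS).
under eq_fun => t.
  rewrite (_ : H t (k *: u + v) = k *: H t u + H t v); last first.
    by have [hL _ _ _] := HA t; rewrite hL.
  rewrite (ipDr ipS) (ipZr ipS).
  over.
apply: tendsD; [apply: tendsM; [exact: tends_cst|exact: Hg]|exact: Hg].
Qed.

Lemma lim_nu : g (nu V) = nu V.
Proof.
apply: lim_uniq => x; under eq_fun => t.
  rewrite (_ : H t (nu V) = nu V); last by case: (HA t).
  over.
exact: tends_cst.
Qed.

Lemma lim_isometric a b : ip (g a) (g b) = ip a b.
Proof.
move: a; apply: grading_ind => [|u v Hu Hv|p a ap].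
- by rewrite (lin0 lim_linear) !(ip0l ipS).
- by rewrite (linD lim_linear) !(ipDl ipS) Hu Hv.
move: b; apply: grading_ind => [|u v Hu Hv|q b bq].
- by rewrite (lin0 lim_linear) !(ip0r ipS).
- by rewrite (linD lim_linear) !(ipDr ipS) Hu Hv.
have [gap Ha] := lim_coord ap; have [gbq Hb] := lim_coord bq.
apply: (@tends_uniq _ _ F (fun t => ip (H t a) (H t b))); last first.
  by under eq_fun do rewrite Hip; exact: tends_cst.
rewrite -(grade_coordK gbq) {1}/grade_vec (ip_sumr ipS).
under eq_fun => t.
  rewrite -(grade_coordK (aut_grade (HA t) bq)) {1}/grade_vec (ip_sumr ipS).
  over.
apply: tends_sum => i _; rewrite (ipZr ipS); under eq_fun do rewrite (ipZr ipS).
apply: tendsM; first exact: Hb.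
rewrite -(ip_conj ipS); under eq_fun do rewrite -(ip_conj ipS).
exact: tends_conj.
Qed.

(** For homogeneous a and b, expanding in the fixed bases makes (x | (H t a)_(n) (H t b)) a
    polynomial in converging coordinates. *)
Lemma lim_mode a n b : g (Y a n b) = Y (g a) n (g b).
Proof.
move: a; apply: grading_ind => [|u v Hu Hv|p a ap].
- by rewrite (lin0 lim_linear) !Y0l (lin0 lim_linear).
- rewrite (linD lim_linear) (linD (va_linearl n _)) (linD lim_linear) Hu Hv.
  by rewrite (linD (va_linearl n _)).
move: b; apply: grading_ind => [|u v Hu Hv|q b bq].
- by rewrite (lin0 lim_linear) !Y0r (lin0 lim_linear).
- rewrite (linD lim_linear) (linD (va_linearr _ n)) (linD lim_linear) Hu Hv.
  by rewrite (linD (va_linearr _ n)).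
have [gap Ha] := lim_coord ap; have [gbq Hb] := lim_coord bq.
apply: lim_uniq => x; under eq_fun => t.
  rewrite (_ : H t (Y a n b) = Y (H t a) n (H t b)); last by case: (HA t).
  rewrite -(grade_coordK (aut_grade (HA t) ap)) -(grade_coordK (aut_grade (HA t) bq)).
  rewrite {1 2}/grade_vec (lin_sum (va_linearl n _)) (ip_sumr ipS).
  under eq_bigr => i _.
    rewrite (linZ (va_linearl n _)) (lin_sum (va_linearr _ n)) (ipZr ipS) (ip_sumr ipS).
    under eq_bigr do rewrite (linZ (va_linearr _ n)) (ipZr ipS).
    over.
  over.
rewrite -(grade_coordK gap) -(grade_coordK gbq).
rewrite {1 2}/grade_vec (lin_sum (va_linearl n _)) (ip_sumr ipS).
apply: tends_sum => i _.
rewrite (linZ (va_linearl n _)) (lin_sum (va_linearr _ n)) (ipZr ipS) (ip_sumr ipS).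
apply: tendsM; first exact: Ha.
apply: tends_sum => j _; rewrite (linZ (va_linearr _ n)) (ipZr ipS).
by apply: tendsM; [exact: Hb|exact: tends_cst].
Qed.

End IsometricLimit.

Section Compact.
Context (R : realType) (V : VOA R) (ip : V -> V -> R[i]).
Context (ipS : scalar_product ip).

(** Along an ultrafilter both h and its inverse have weak limits g and g'. They are isometric and
    adjoint to each other, hence mutually inverse, so g is again an automorphism and the limit of
    h. *)
Lemma isometric_compact : (forall (g : aut V) a b, ip (g a) (g b) = ip a b) ->
  compact [set: aut V].
Proof.
move=> iso; rewrite compact_ultra => F FU _.
have [inv invP] := choice (fun h : aut V => aut_inv (svalP h)).
have iso' h a b : ip (inv h a) (inv h b) = ip a b.
  by have [_ fK _] := invP h; rewrite -(iso h) /aut_fun !fK.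
have [g Hg] := choice (lim_ex ipS FU (fun h => svalP h) iso).
have [g' Hg'] := choice (lim_ex ipS FU (fun h => let: And3 hA _ _ := invP h in hA) iso').
have adj x v : ip (g' x) v = ip x (g v).
  apply: (@tends_uniq _ _ F (fun h : aut V => ip x (h v))); last exact: Hg.
  rewrite -(ip_conj ipS); under eq_fun => h.
    rewrite (_ : ip x (h v) = (ip v (inv h x))^*); last first.
      by rewrite (ip_conj ipS) -(iso h (inv h x)) /aut_fun; have [_ -> _] := invP h.
    over.
  exact: tends_conj.
have giso := lim_isometric ipS FU (fun h => svalP h) iso Hg.
have giso' := lim_isometric ipS FU (fun h => let: And3 hA _ _ := invP h in hA) iso' Hg'.
have gA : is_aut g.
  split.
  - exact: (lim_linear ipS FU (fun h => svalP h) Hg).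
  - exists g' => v; apply: (ip_inj ipS) => x.
      by rewrite -(ip_conj ipS) adj giso (ip_conj ipS).
    by rewrite -adj giso'.
  - exact: (lim_mode ipS FU (fun h => svalP h) iso Hg).
  - exact: (lim_nu ipS FU (fun h => svalP h) Hg).
exists (exist _ g gA); split=> //; apply: aut_cvg => n i j.
under eq_fun do rewrite mxE; rewrite mxE.
have [_] := lim_coord ipS FU (fun h => svalP h) iso Hg
  ((@grade_basisP _ V n).1 j); exact.
Qed.

End Compact.

(** * Spectra of automorphisms *)

Section Spectrum.
Context (R : realType) (V : VOA R).
Local Notation K := R[i].

(** The kernels of (f - x)^2 and f - x coincide, so there are no nontrivial Jordan blocks. *)
Definition semisimple (f : V -> V) := forall x v,
  f (f v - x *: v) = x *: (f v - x *: v) -> f v = x *: v.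

(** The columns of Q are the coordinates of an eigenbasis of V_n, with eigenvalues e. *)
Definition diagonalized (f : V -> V) n (Q : 'M[K]_(grade_dim V n))
    (e : 'rV[K]_(grade_dim V n)) :=
  Q \in unitmx /\ forall k,
  f (grade_vec (Q *m delta_mx k 0)) = e 0 k *: grade_vec (Q *m delta_mx k 0).

Lemma delta_sum m (c : 'cV[K]_m) : c = \sum_k c k 0 *: delta_mx k 0.
Proof.
apply/colP => i; rewrite summxE (bigD1 i) //= big1 ?addr0 => [|k ki].
  by rewrite !mxE !eqxx mulr1.
by rewrite !mxE eq_sym (negbTE ki) mulr0.
Qed.

Lemma diagonalized_expand n (Q : 'M[K]_(grade_dim V n)) v :
  Q \in unitmx -> grade n v ->
  v = \sum_k (invmx Q *m grade_coord n v) k 0 *: grade_vec (Q *m delta_mx k 0).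
Proof.
move=> Qu vn; rewrite -{1}(grade_coordK vn).
rewrite -{1}[grade_coord n v](mulKVmx Qu) {1}[invmx Q *m _]delta_sum mulmx_sumr.
rewrite (lin_sum (@grade_vec_linear _ _ n)); apply: eq_bigr => k _.
by rewrite -scalemxAr (linZ (@grade_vec_linear _ _ n)).
Qed.

Lemma diagonalized_op_mx f n (Q : 'M[K]_(grade_dim V n))
    (e : 'rV[K]_(grade_dim V n)) : linear f ->
  diagonalized f Q e -> op_mx n f = Q *m diag_mx e *m invmx Q.
Proof.
move=> fL [Qu Qe]; apply: op_mxE => c.
rewrite {1}[grade_vec c](diagonalized_expand Qu (grade_vecP c)) grade_vecK.
rewrite (lin_sum fL) -!mulmxA.
set u := invmx Q *m c.
rewrite [diag_mx e *m u]delta_sum mulmx_sumr (lin_sum (@grade_vec_linear _ _ n)).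
apply: eq_bigr => k _; rewrite -scalemxAr (linZ (@grade_vec_linear _ _ n)).
rewrite (linZ fL) Qe scalerA; congr (_ *: _).
by rewrite mul_diag_mx [RHS]mxE mulrC.
Qed.

Lemma diagonalized_neq0 n (Q : 'M[K]_(grade_dim V n)) k : Q \in unitmx ->
  grade_vec (Q *m delta_mx k 0) != 0 :> V.
Proof.
move=> Qu; apply/eqP => /(congr1 (grade_coord n)).
rewrite -(lin0 (@grade_vec_linear _ _ n)) !grade_vecK => /(congr1 (mulmx (invmx Q))).
by rewrite mulKmx // mulmx0 => /colP/(_ k)/eqP; rewrite !mxE !eqxx oner_eq0.
Qed.

Lemma semisimple_diagonalized g n : is_aut g -> semisimple g ->
  exists (Q : 'M[K]_(grade_dim V n)) (e : 'rV[K]_(grade_dim V n)), diagonalized g Q e.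
Proof.
move=> gA gss; have [gL _ _ _] := gA.
have vecE x c : grade_vec ((op_mx n g - x%:M) *m c) =
    g (grade_vec c) - x *: grade_vec c :> V.
  rewrite mulmxBl (linB (@grade_vec_linear _ _ n)) mul_scalar_mx.
  rewrite (linZ (@grade_vec_linear _ _ n)) -op_vec // => v; exact: aut_grade.
have [x c|Q [e [Qu gQ]]] := @semisimple_diagonalizable _ _ (op_mx n g).
  move=> /(congr1 (@grade_vec _ V n)); rewrite !vecE (lin0 (@grade_vec_linear _ _ n)).
  move=> /eqP; rewrite subr_eq0 => /eqP/gss/eqP; rewrite -subr_eq0 -vecE => /eqP.
  by rewrite -(lin0 (@grade_vec_linear _ _ n)) => /(can_inj (@grade_vecK _ _ n)).
exists Q, e; split=> // k.
rewrite op_vec //; last by move=> v; exact: aut_grade.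
rewrite gQ -!mulmxA mulKmx // -(linZ (@grade_vec_linear _ _ n)) scalemxAr.
congr (grade_vec (Q *m _)); rewrite mul_diag_mx.
by apply/colP => i; rewrite !mxE; case: eqP => [->|]; rewrite ?mulr0.
Qed.

Lemma semisimple_spanned g : is_aut g -> semisimple g -> spanned_by_eigenvectors g.
Proof.
move=> gA gss; have [gL _ _ _] := gA.
apply: grading_ind => [|u v [l gl ->] [m gm ->]|n v vn].
- by exists [::] => //; rewrite big_nil.
- by exists (l ++ m); [exact: eigenlist_cat|rewrite big_cat].
- have [Q [e [Qu Qe]]] := semisimple_diagonalized n gA gss.
  exists [seq (e 0 k, (invmx Q *m grade_coord n v) k 0 *:
      grade_vec (Q *m delta_mx k 0)) | k <- index_enum 'I_(grade_dim V n)].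
    by move=> p /mapP[k _ ->] /=; rewrite (linZ gL) Qe !scalerA mulrC.
  by rewrite big_map /=; exact: diagonalized_expand.
Qed.

Lemma diagonalized_fcalc g n (Q : 'M[K]_(grade_dim V n))
    (e : 'rV[K]_(grade_dim V n)) chi : linear g ->
  diagonalized g Q e ->
  diagonalized (fcalc g chi) Q (\row_k chi (e 0 k)).
Proof.
by move=> gL [Qu Qe]; split=> // k; rewrite mxE; exact: fcalc_eigen.
Qed.

Lemma diagonalized_trace f n (Q : 'M[K]_(grade_dim V n))
    (e : 'rV[K]_(grade_dim V n)) : linear f ->
  diagonalized f Q e -> \tr (op_mx n f) = \sum_k e 0 k.
Proof.
move=> fL Qe; rewrite (diagonalized_op_mx fL Qe) mxtrace_mulC mulKmx ?mxtrace_diag //.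
by case: Qe.
Qed.

Context (ip : V -> V -> K) (ipS : scalar_product ip).

Lemma isometric_eigen g x v : (forall a b, ip (g a) (g b) = ip a b) ->
  g v = x *: v -> v != 0 -> x^* * x = 1.
Proof.
move=> iso gv v0; have vv : ip v v != 0.
  by apply: contra_neq v0; exact: (ip_eq0 ipS).
by apply: (mulIf vv); rewrite mul1r -{2}(iso v v) gv (ipZl ipS) (ipZr ipS) mulrA.
Qed.

(** If w = g u - x u satisfies g w = x w with w nonzero, then |x| = 1, and replacing (w | u) by (g w
    | g u) in (w | g u - x u) gives (w | w) = 0. *)
Lemma isometric_semisimple g : (forall a b, ip (g a) (g b) = ip a b) -> semisimple g.
Proof.
move=> iso x u; set w := g u - _ => gw; apply/eqP; rewrite -subr_eq0 -/w.
apply: contraT => w0; have xx := isometric_eigen iso gw w0.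
have : ip w w = 0.
  rewrite {2}/w (linB (ip_linearr ipS w)) (ipZr ipS) -(iso w u) gw (ipZl ipS).
  by rewrite mulrA [x * _]mulrC xx mul1r subrr.
by move/(ip_eq0 ipS)/eqP; rewrite (negbTE w0).
Qed.

Lemma selfadjoint_eigen g x v : (forall a b, ip (g a) b = ip a (g b)) ->
  g v = x *: v -> v != 0 -> x^* = x.
Proof.
move=> sa gv v0; have vv : ip v v != 0.
  by apply: contra_neq v0; exact: (ip_eq0 ipS).
by apply: (mulIf vv); rewrite -(ipZl ipS) -(ipZr ipS) -gv sa.
Qed.

Lemma selfadjoint_semisimple g : (forall a b, ip (g a) b = ip a (g b)) -> semisimple g.
Proof.
move=> sa x u; set w := g u - _ => gw; apply/eqP; rewrite -subr_eq0 -/w.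
apply: contraT => w0; have xx := selfadjoint_eigen sa gw w0.
have : ip w w = 0.
  by rewrite {2}/w (linB (ip_linearr ipS w)) (ipZr ipS) -sa gw (ipZl ipS) xx subrr.
by move/(ip_eq0 ipS)/eqP; rewrite (negbTE w0).
Qed.

End Spectrum.

(** * Torsion of the spectrum and connected components *)

Section Logarithm.
Context (K : fieldType) (R : numFieldType) (z : K).

(** The graph of a homomorphism from a subgroup of K^* containing z to the additive group R, sending
    z to 1. *)
Let partial_log (A : set (K * R)) :=
  [/\ forall p, A p -> p.1 != 0,
      forall p q, A p -> A q -> A (p.1 / q.1, p.2 - q.2),
      forall t, A (1, t) -> t = 0 &
      A (z, 1)].

Section PartialLog.
Context (A : set (K * R)) (gA : partial_log A).

Let A1 : A (1, 0).
Proof.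
have [Anz Adiv _ Az] := gA.
have := Adiv _ _ Az Az; rewrite /= subrr divff //; exact: (Anz _ Az).
Qed.

Let AV x s : A (x, s) -> A (x^-1, - s).
Proof.
have [_ Adiv _ _] := gA.
by move=> /(Adiv _ _ A1); rewrite /= div1r sub0r.
Qed.

Lemma partial_logM x s y t : A (x, s) -> A (y, t) -> A (x * y, s + t).
Proof.
have [_ Adiv _ _] := gA => xs /AV yt.
by have := Adiv _ _ xs yt; rewrite /= invrK opprK.
Qed.

Lemma partial_log_inj x s t : A (x, s) -> A (x, t) -> s = t.
Proof.
have [Anz Adiv A10 _] := gA => xs xt.
have := Adiv _ _ xs xt; rewrite /= divff; last exact: (Anz _ xs).
by move=> /A10/eqP; rewrite subr_eq0 => /eqP.
Qed.

Lemma partial_logX x s (k : int) : A (x, s) -> A (x ^ k, s *~ k).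
Proof.
have pos m : A (x, s) -> A (x ^+ m, s *+ m).
  move=> xs; elim: m => [|m IHm]; first by rewrite expr0 mulr0n.
  by rewrite exprS mulrS; exact: partial_logM.
case: k => m xs; first exact: pos.
by rewrite NegzE -invr_expz mulrNz; apply: AV; exact: pos.
Qed.

(** The domain is enlarged by the powers of w, sent to multiples of some s. Divisibility of R
    supplies s = t / (m + 1) when w^(m+1) already has the value t; if no positive power of w is in
    the domain, s = 0 will do. *)
Lemma partial_log_extend w : w != 0 -> exists B, [/\ partial_log B, A `<=` B & exists s, B (w, s)].
Proof.
move=> w0; have [Anz Adiv A10 Az] := gA.
have [s sP] : exists s : R, forall (k : int) t, A (w ^ k, t) -> t = s *~ k.
  have [[m [t wmt]]|nA] := pselect (exists m t, A (w ^+ m.+1, t)).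
    exists (t / m.+1%:R) => k u wku.
    have E : u *~ m.+1 = t *~ k.
      apply: partial_log_inj (partial_logX m.+1 wku) _.
      by rewrite exprzAC; exact: partial_logX.
    apply: (@mulIf _ m.+1%:R); first by rewrite pnatr_eq0.
    by rewrite mulr_natr [LHS]E -[in RHS]mulrzl -mulrA divfK ?pnatr_eq0 // mulrzl.
  exists 0 => k t wkt; rewrite mul0rz; case: k wkt => [[|m]|m] wkt.
  - exact: A10.
  - by case: nA; exists m, t.
  - case: nA; exists m, (- t).
    by have := AV wkt; rewrite NegzE -invr_expz invrK.
exists [set p | exists (k : int) a, A a /\ p = (a.1 * w ^ k, a.2 + s *~ k)].
split; last 2 first.
- by move=> [x t] xt; exists 0, (x, t); split=> //=; rewrite mulr1 addr0.
- by exists s, 1, (1, 0); split=> //=; rewrite mul1r add0r.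
split.
- move=> _ [k [a [Aa ->]]] /=; rewrite mulf_neq0 ?expfz_neq0 //; exact: Anz.
- move=> _ _ [k [a [Aa ->]]] [l [b [Ab ->]]] /=.
  exists (k - l), (a.1 / b.1, a.2 - b.2); split; first exact: Adiv.
  rewrite /= expfzDr // -invr_expz mulrzBr; congr pair; last by ring.
  by field; rewrite expfz_neq0 // Anz.
- move=> t [k [[x u] [/= Aa [E ->]]]].
  have xw : w ^ k = x^-1.
    have x0 : x != 0 := Anz _ Aa.
    by apply: (mulfI x0); rewrite -E divff.
  have := AV Aa; rewrite -xw => /sP <-; exact: subrr.
- by exists 0, (z, 1); split=> //=; rewrite mulr1 addr0.
Qed.

End PartialLog.

(** A divisible group is injective: z^k -> k is well defined as z is not a root of unity, and Zorn's
    lemma extends it to all of K^*. *)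
Lemma nontorsion_log : z != 0 -> (forall n, z ^+ n.+1 != 1) ->
  exists phi : K -> R, phi z = 1 /\
    forall x y, x != 0 -> y != 0 -> phi (x * y) = phi x + phi y.
Proof.
move=> z0 znt.
pose G0 := [set p : K * R | exists k : int, p = (z ^ k, k%:~R)].
have G0_log : partial_log G0.
  split.
  - by move=> _ [k ->] /=; rewrite expfz_neq0.
  - by move=> _ _ [k ->] [l ->]; exists (k - l); rewrite /= expfzDr // -invr_expz intrB.
  - move=> t [k [/esym zk ->]]; case: k zk => [[|m]|m] //=.
      by move=> zm; have := znt m; rewrite -[z ^+ _]/(z ^ Posz m.+1) zm eqxx.
    rewrite NegzE -invr_expz => zm; have := znt m.
    by rewrite -[z ^+ _]/(z ^ Posz m.+1) -[z ^ _]invrK zm invr1 eqxx.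
  - by exists 1.
have [F FP Ftot|A [PA Amax]] := @Zorn_bigcup _ [set A | A = set0 \/ partial_log A].
  have gF X p : F X -> X p -> partial_log X.
    by move=> /FP[->|].
  have [[X0 [FX0 [p0 X0p0]]]|F0] := pselect (exists X, F X /\ X !=set0); last first.
    left; apply/seteqP; split=> // p [X FX Xp].
    by apply: F0; exists X; split=> //; exists p.
  right; have X0_log := gF _ _ FX0 X0p0; split.
  - by move=> p [X FX Xp]; have [+ _ _ _] := gF _ _ FX Xp; apply.
  - move=> p q [X FX Xp] [Y FY Yq].
    have [XY|YX] := Ftot _ _ FX FY.
      by exists Y => //; have [_ + _ _] := gF _ _ FY Yq; apply=> //; exact: XY.
    by exists X => //; have [_ + _ _] := gF _ _ FX Xp; apply=> //; exact: YX.
  - by move=> t [X FX Xt]; have [_ _ + _] := gF _ _ FX Xt; apply.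
  - by exists X0 => //; have [] := X0_log.
have gA : partial_log A.
  case: PA => // A0; exfalso; apply: (Amax G0); last by right.
  rewrite A0; split=> // /(_ (z, 1)); apply; by exists 1.
have Atot w : w != 0 -> exists s, A (w, s).
  move=> w0; have [B [gB AB [s Bs]]] := partial_log_extend gA w0.
  exists s; apply: contrapT => nAs; apply: (Amax B); last by right.
  by split=> // BA; apply: nAs; exact: BA.
pose phi x := xget 0 [set s | A (x, s)].
have phiP x : x != 0 -> A (x, phi x).
  by move=> /Atot[s xs]; rewrite /phi; case: xgetP => [? _ //|/(_ s)].
exists phi; split.
  by have [_ _ _ Az] := gA; apply: (partial_log_inj gA (phiP _ z0) Az).
move=> x y x0 y0; apply: (partial_log_inj gA (phiP _ (mulf_neq0 x0 y0))).
by apply: partial_logM => //; exact: phiP.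
Qed.

End Logarithm.

Section AlgebraicNumbers.
Context (R : realType).
Local Notation K := R[i].
Local Notation algebraic z := (algebraicOver (ratr : rat -> K) z).

Lemma algebraic_countable : countable [set z : K | algebraic z].
Proof.
apply: (@sub_countable _ _ _ (\bigcup_(p in [set p : {poly rat} | p != 0])
    [set z : K | root (map_poly ratr p) z])).
  by apply: subset_card_le => z [p p0 pz]; exists p.
apply: bigcup_countable => [|p p0]; first exact: countableP.
apply: finite_set_countable.
have [rs rsE] := closed_field_poly_normal (map_poly (ratr : rat -> K) p).
apply: (sub_finite_set _ (finite_seq rs)) => z /=.
rewrite rsE rootZ ?root_prod_XsubC //.
by rewrite lead_coef_eq0 map_poly_eq0.
Qed.

Lemma root_of_unity_algebraic (z : K) n : z ^+ n.+1 = 1 -> algebraic z.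
Proof.
move=> zn; exists ('X^(n.+1) - 1%:P); first exact/monic_neq0/monicXnsubC.
rewrite rmorphB /= map_polyXn map_polyC /root !hornerE zn.
by rewrite -[X in _ - X]/(ratr 1) rmorph1 subrr.
Qed.

(** A connected set with two distinct points contains a segment of positive Lebesgue measure,
    whereas real parts of algebraic numbers form a countable set. *)
Lemma connected_algebraic_cst (B : set R) (x y : R) : connected B ->
  (forall r, B r -> exists2 z : K, algebraic z & complex.Re z = r) ->
  B x -> B y -> x = y.
Proof.
move=> Bc Balg; wlog xy : x y / x <= y.
  by move=> W Bx By; have [/W|/ltW/W] := leP x y; [apply|move=> W'; apply/esym/W'].
move=> Bx By; apply/eqP; rewrite eq_le xy leNgt /=; apply/negP => lt_xy.
have sub : `[x, y]%classic `<=` (@complex.Re R) @` [set z : K | algebraic z].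
  move=> r; rewrite /= in_itv /= => /andP[xr ry].
  have [z za <-] : exists2 z : K, algebraic z & complex.Re z = r.
    by apply: Balg; have /connected_intervalP/(_ x y Bx By r) := Bc; apply; rewrite xr ry.
  by exists z.
have cnt : countable `[x, y]%classic.
  apply: sub_countable (subset_card_le sub) _.
  exact: card_le_trans (card_image_le _ _) algebraic_countable.
have := countable_lebesgue_measure0 cnt.
rewrite lebesgue_measure_itv /= lte_fin lt_xy -EFinB => -[] /eqP.
by rewrite subr_eq0 gt_eqF.
Qed.

End AlgebraicNumbers.

Lemma aut_eq (R : realType) (V : VOA R) (g h : aut V) : g =1 h -> g = h.
Proof.
case: g h => [g gA] [h hA] /= /funext gh; subst h.
by congr exist; exact: Prop_irrelevance.
Qed.

Lemma op_mx_comp (R : realType) (V : VOA R) n (f g : V -> V) :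
  is_aut f -> is_aut g -> op_mx n (f \o g) = op_mx n f *m op_mx n g.
Proof.
move=> fA gA; have [fL _ _ _] := fA; have [gL _ _ _] := gA.
by apply: op_mxE => c /=; rewrite !op_vec ?mulmxA // => v; exact: aut_grade.
Qed.

Lemma Re_trace_continuous (R : realType) (V : VOA R) n (A : 'M[R[i]]_(grade_dim V n)) :
  continuous (fun h : aut V => complex.Re (\tr (A *m op_mx n h))).
Proof.
move=> h; apply: (@continuous_comp _ _ _
  (fun h : aut V => \tr (A *m op_mx n h) : R[i]^o) (fun z : R[i]^o => complex.Re z)).
  suff : tends (nbhs h) (fun h : aut V => \tr (A *m op_mx n h))
    (\tr (A *m op_mx n (aut_fun h))).
    exact.
  rewrite /mxtrace; apply: tends_sum => i _.
  rewrite mxE; under eq_fun do rewrite mxE.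
  apply: tends_sum => j _; apply: tendsM; first exact: tends_cst.
  exact: (@aut_mx_continuous R V n j i).
exact: Re_continuous.
Qed.

Lemma norm1_Re1 (R : realType) (z : R[i]) : z^* * z = 1 -> complex.Re z <= 1 /\
  (complex.Re z = 1 -> z = 1).
Proof.
case: z => a b.
rewrite mulrC -normCK normc_def -rmorphXn /= sqr_sqrtr ?addr_ge0 ?sqr_ge0 //.
move=> /(congr1 (@complex.Re R)) /= ab1; split.
  have a1 : `|a| <= 1.
    rewrite -(@ler_pXn2r _ 2) ?nnegrE // expr1n real_normK ?num_real // -ab1.
    by rewrite lerDl sqr_ge0.
  exact: le_trans (ler_norm a) a1.
move=> a1; move: ab1; rewrite a1 expr1n => /eqP.
by rewrite -subr_eq0 addrAC subrr add0r sqrf_eq0 => /eqP ->.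
Qed.

(** * Compactness of Aut(V) and total disconnectedness *)

Section CompactCase.
Context (R : realType) (V : VOA R) (ip : V -> V -> R[i]).
Context (ipS : scalar_product ip) (autC : compact [set: aut V]).
Local Notation K := R[i].

(* Otherwise a homomorphism phi : K^* -> R with phi (e 0 k) = 1 yields the
   automorphisms exp (j * phi), j in nat, whose traces on V_n are unbounded. *)
Lemma compact_isometric_torsion (g : V -> V) n (Q : 'M[K]_(grade_dim V n))
    (e : 'rV[K]_(grade_dim V n)) k :
  is_aut g -> (forall a b, ip (g a) (g b) = ip a b) -> diagonalized g Q e ->
  exists m, (e 0 k) ^+ m.+1 = 1.
Proof.
move=> gA iso gQ; have [gL gB _ _] := gA; have [Qu Qe] := gQ.
apply: contrapT => nt.
have e0 : e 0 k != 0.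
  have := isometric_eigen ipS iso (Qe k) (diagonalized_neq0 k Qu).
  by apply: contra_eq_neq => ->; rewrite mulr0 eq_sym oner_eq0.
have [|phi [phik phiM]] := nontorsion_log R e0.
  by move=> m; apply/eqP => em; apply: nt; exists m.
have gS := semisimple_spanned gA (isometric_semisimple ipS iso).
have phi1 : phi 1 = 0.
  by apply: (addrI (phi 1)); rewrite addr0 -phiM ?oner_neq0 // mulr1.
pose chi (j : nat) (x : K) := (expR (j%:R * phi x))%:C%C.
have chiA j : is_aut (fcalc g (chi j)).
  apply: fcalc_aut => //; first by rewrite /chi phi1 mulr0 expR0.
  by move=> x y x0 y0; rewrite /chi phiM // mulrDr expRD rmorphM.
pose tr (h : aut V) := complex.Re (\tr (1%:M *m op_mx n h)).
have trE j : tr (exist _ _ (chiA j)) = \sum_l expR (j%:R * phi (e 0 l)).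
  rewrite /tr mul1mx (diagonalized_trace _ (diagonalized_fcalc (chi j) gL gQ)).
    by rewrite raddf_sum; apply: eq_bigr => l _; rewrite mxE.
  by have [] := chiA j.
(* On a compact group the continuous function [tr] attains a maximum, at [h0]. *)
have [||h0 _ h0max] := compact_EVT_max (f := tr) _ autC.
- by exists (exist _ _ (chiA 0%N)).
- exact/continuous_subspaceT/Re_trace_continuous.
have [j hj] : exists j : nat, tr h0 < j%:R.
  exists (Num.bound `|tr h0|); apply: le_lt_trans (ler_norm _) _.
  exact: archi_boundP (normr_ge0 _).
have := h0max (exist _ _ (chiA j)); rewrite in_setT => /(_ isT).
rewrite leNgt => /negP; apply; rewrite trE (bigD1 k) //= phik mulr1.
apply: (lt_le_trans hj); apply: ler_wpDr.
  by apply: sumr_ge0 => l _; exact: expR_ge0.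
by apply: le_trans (expR_ge1Dx _); rewrite lerDr.
Qed.

Lemma compact_totally_disconnected : totally_disconnected (isometric_aut ip).
Proof.
move=> x xiso; apply/seteqP; split; last first.
  by move=> _ ->; exact: connected_component_refl.
move=> y [B [Bx Biso Bc] By] /=.
(* Translation by the inverse [f] of x moves the base point of the component to the identity. *)
have [f [fA fK gK]] := aut_inv (svalP x).
have comp_iso (z : aut V) : B z ->
    is_aut (f \o z) /\ (forall a b, ip ((f \o z) a) ((f \o z) b) = ip a b).
  move=> Bz; split; first exact: is_aut_comp fA (svalP z).
  move=> a b; have := xiso (f (z a)) (f (z b)).
  by rewrite /aut_fun !fK => <-; exact: (Biso _ Bz).
have fy v : f (aut_fun y v) = v.
  have [hA hiso] := comp_iso _ By; have [hL _ _ _] := hA.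
  rewrite -[LHS]/((f \o aut_fun y) v).
  move: v; apply: grading_ind => [|u v Hu Hv|n v vn].
  - exact: (lin0 hL).
  - by rewrite (linD hL) Hu Hv.
  pose tr (h : aut V) := complex.Re (\tr (op_mx n f *m op_mx n h)).
  (* Each f z with z in B is isometric, so its trace is a sum of roots of unity. *)
  have tr_alg r : (tr @` B) r ->
      exists2 z : K, algebraicOver (ratr : rat -> K) z & complex.Re z = r.
    move=> [z Bz <-]; rewrite /tr -op_mx_comp //; last exact: svalP.
    have [zA ziso] := comp_iso _ Bz.
    have [Q [e Qe]] := semisimple_diagonalized n zA (isometric_semisimple ipS ziso).
    exists (\tr (op_mx n (f \o aut_fun z))) => //.
    rewrite (diagonalized_trace _ Qe); last by have [] := zA.
    apply: big_ind => [||k _]; [exact: algebraic0|exact: algebraic_add|].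
    have [m em] := compact_isometric_torsion k zA ziso Qe.
    exact: root_of_unity_algebraic em.
  have trc : connected (tr @` B).
    apply: connected_continuous_connected => //.
    exact/continuous_subspaceT/Re_trace_continuous.
  have trxy : tr y = tr x.
    apply: (connected_algebraic_cst trc tr_alg); first by exists y.
    by exists x.
  have [Q [e [Qu Qe]]] := semisimple_diagonalized n hA (isometric_semisimple ipS hiso).
  have e_norm k : (e 0 k)^* * e 0 k = 1.
    exact: (isometric_eigen ipS hiso (Qe k) (diagonalized_neq0 k Qu)).
  have trx : tr x = \sum_(k < grade_dim V n) 1.
    rewrite /tr -op_mx_comp //; last exact: svalP.
    have -> : op_mx n (f \o aut_fun x) = 1%:M.
      by apply: op_mxE => c; rewrite /= gK mul1mx.
    by rewrite mxtrace1 raddfMn /= sumr_const card_ord.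
  have tryE : tr y = \sum_(k < grade_dim V n) complex.Re (e 0 k).
    rewrite /tr -op_mx_comp //; last exact: svalP.
    by rewrite (diagonalized_trace hL (conj Qu Qe)) raddf_sum.
  (* The real parts of the eigenvalues are at most 1 and sum to dim V_n, so each equals 1; modulus 1
     then forces the eigenvalue to be 1. *)
  have e1 k : e 0 k = 1.
    apply: (norm1_Re1 (e_norm k)).2.
    have : \sum_(k < grade_dim V n) (1 - complex.Re (e 0 k)) = 0.
      by rewrite sumrB -tryE -trx trxy subrr.
    move=> /eqP; rewrite psumr_eq0 => [|l _]; last first.
      by rewrite subr_ge0; exact: (norm1_Re1 (e_norm l)).1.
    by move=> /allP/(_ k (mem_index_enum _)); rewrite subr_eq0 => /eqP.
  rewrite {1}(diagonalized_expand Qu vn) (lin_sum hL).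
  under eq_bigr do rewrite (linZ hL) Qe e1 scale1r.
  by rewrite -diagonalized_expand.
apply: aut_eq => v; apply: (can_inj fK).
by rewrite fy; exact: esym (gK v).
Qed.

End CompactCase.

(** * Paths of isometric automorphisms *)

Section UnitaryPath.
Context (R : realType) (V : VOA R) (ip : V -> V -> R[i]).
Context (ipS : scalar_product ip).
Local Notation K := R[i].
Context (g : V -> V) (gA : is_aut g).
Context (gsa : forall a b, ip (g a) b = ip a (g b)).

Definition log_norm (x : K) : R := ln (complex.Re `|x|).

(* the character x |-> |x|^(i t) *)
Definition unitary_char (t : R) (x : K) : K :=
  (cos (t * log_norm x) +i* sin (t * log_norm x))%C.

Lemma log_normM x y : x != 0 -> y != 0 ->
  log_norm (x * y) = log_norm x + log_norm y.
Proof.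
have nE z : `|z| = (complex.Re `|z|)%:C%C :> K by rewrite RRe_real // normr_real.
have pos (z : K) : z != 0 -> complex.Re `|z| \is Num.pos.
  move=> z0; have : 0 < `|z| by rewrite normr_gt0.
  by rewrite nE ltcR.
move=> x0 y0; rewrite /log_norm normrM {1}[`|x|]nE {1}[`|y|]nE -rmorphM /=.
by rewrite lnM ?pos.
Qed.

Lemma unitary_charM t x y : x != 0 -> y != 0 ->
  unitary_char t (x * y) = unitary_char t x * unitary_char t y.
Proof.
move=> x0 y0; rewrite /unitary_char log_normM // mulrDr cosD sinD.
by apply/eqP; rewrite eq_complex /= eqxx /= [X in _ == X]addrC.
Qed.

Lemma unitary_char1 t : unitary_char t 1 = 1.
Proof. by rewrite /unitary_char /log_norm normr1 ln1 mulr0 cos0 sin0. Qed.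

Lemma unitary_char0 x : unitary_char 0 x = 1.
Proof. by rewrite /unitary_char mul0r cos0 sin0. Qed.

Lemma unitary_char_norm t x : (unitary_char t x)^* * unitary_char t x = 1.
Proof.
rewrite mulrC -normCK normc_def -rmorphXn /= sqr_sqrtr ?addr_ge0 ?sqr_ge0 //.
by rewrite cos2Dsin2.
Qed.

Lemma unitary_char_continuous x t :
  tends (nbhs t) (fun s => unitary_char s x) (unitary_char t x).
Proof.
have lin : continuous (fun s : R => s * log_norm x).
  by move=> s; exact: (@mulrr_continuous).
apply: cvg_complex => /=.
- by apply: (continuous_comp (lin t)); exact: continuous_cos.
- by apply: (continuous_comp (lin t)); exact: continuous_sin.
Qed.

Let gS := semisimple_spanned gA (selfadjoint_semisimple ipS gsa).

Lemma unitary_path_aut t : is_aut (fcalc g (unitary_char t)).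
Proof.
by apply: fcalc_aut => //; [exact: unitary_char1|exact: unitary_charM].
Qed.

Definition unitary_path t : aut V := exist _ _ (unitary_path_aut t).

(** The eigenvalues of the self-adjoint g are real and eigenvectors for distinct ones are
    orthogonal, so only pairs with equal eigenvalue contribute, and there the character has modulus
    1. *)
Lemma unitary_path_isometric t : isometric_aut ip (unitary_path t).
Proof.
have [gL _ _ _] := gA.
move=> a b; rewrite /unitary_path /aut_fun /=.
have [l gl ->] := gS a; have [m gm ->] := gS b.
rewrite !fcalcE // !(ip_sumr ipS); apply: eq_big_seq => q qm.
rewrite -[RHS](ip_conj ipS) -[LHS](ip_conj ipS); congr (_^*).
rewrite !(ip_sumr ipS); apply: eq_big_seq => p pl.
rewrite (ipZl ipS) (ipZr ipS).
have [->|p0] := eqVneq p.2 0; first by rewrite !(ip0r ipS) !mulr0.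
have [->|q0] := eqVneq q.2 0; first by rewrite !(ip0l ipS) !mulr0.
have px := selfadjoint_eigen ipS gsa (gl _ pl) p0.
have qx := selfadjoint_eigen ipS gsa (gm _ qm) q0.
have [->|pq] := eqVneq p.1 q.1; first by rewrite mulrA unitary_char_norm mul1r.
suff -> : ip q.2 p.2 = 0 by rewrite !mulr0.
apply/eqP; have := gsa q.2 p.2.
rewrite (gl _ pl) (gm _ qm) (ipZl ipS) (ipZr ipS) qx => /eqP.
by rewrite -subr_eq0 -mulrBl mulf_eq0 subr_eq0 eq_sym (negbTE pq).
Qed.

Lemma unitary_path0 v : unitary_path 0 v = v.
Proof.
have [gL gB _ _] := gA; apply: (fcalc_id gL gS _ (bij_inj gB)) => x _.
exact: unitary_char0.
Qed.

(** A single eigenbasis of g on V_n diagonalizes the whole path, so only the diagonal entries depend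
    on t. *)
Lemma unitary_path_continuous : continuous unitary_path.
Proof.
have [gL _ _ _] := gA.
move=> t; apply: aut_cvg => n i j.
have [Q [e Qe]] := semisimple_diagonalized n gA (selfadjoint_semisimple ipS gsa).
suff : tends (nbhs t) (fun s => op_mx n (unitary_path s) i j)
  (op_mx n (unitary_path t) i j).
  exact.
have opE s : op_mx n (unitary_path s) =
    Q *m diag_mx (\row_k unitary_char s (e 0 k)) *m invmx Q.
  apply: diagonalized_op_mx; last exact: diagonalized_fcalc.
  by have [] := unitary_path_aut s.
under eq_fun do rewrite opE mul_mx_diag mxE; rewrite opE mul_mx_diag mxE.
apply: tends_sum => k _; under eq_fun do rewrite !mxE; rewrite !mxE.
apply: tendsM; last exact: tends_cst.
by apply: tendsM; [exact: tends_cst|exact: unitary_char_continuous].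
Qed.

Lemma totally_disconnected_positive_aut :
  (forall a, a != 0 -> 0 < ip (g a) a) ->
  totally_disconnected (isometric_aut ip) -> forall v, g v = v.
Proof.
have [gL _ _ _] := gA; move=> gpos td.
(* The image of the real line is connected and contains the identity, so it lies in a one-point
   component. *)
have path_id t v : unitary_path t v = v.
  have p0 := td (unitary_path 0) (unitary_path_isometric 0).
  have : connected_component (isometric_aut ip) (unitary_path 0) (unitary_path t).
    exists (unitary_path @` setT); last by exists t.
    split; first by exists 0.
      by move=> _ [s _ <-]; exact: unitary_path_isometric.
    apply: connected_continuous_connected; first exact/connected_intervalP.
    exact/continuous_subspaceT/unitary_path_continuous.
  by rewrite p0 => E; rewrite (E : unitary_path t = unitary_path 0) unitary_path0.
apply: grading_ind => [|u v Hu Hv|n v vn]; first exact: lin0.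
  by rewrite (linD gL) Hu Hv.
have [Q [e [Qu Qe]]] := semisimple_diagonalized n gA (selfadjoint_semisimple ipS gsa).
suff e1 k : e 0 k = 1.
  rewrite {1}(diagonalized_expand Qu vn) (lin_sum gL).
  under eq_bigr do rewrite (linZ gL) Qe e1 scale1r.
  by rewrite -diagonalized_expand.
set w := grade_vec (Q *m delta_mx k 0) in Qe *.
have w0 : w != 0 := diagonalized_neq0 k Qu.
have epos : 0 < e 0 k.
  have [_ _ /(_ w w0) ww] := ipS.
  by have := gpos w w0; rewrite gsa Qe (ipZr ipS) pmulr_lgt0.
have ln0 : log_norm (e 0 k) = 0.
  apply/eqP; apply: contraT => l0.
  (* At this time the character takes the value -1 on the eigenvalue, which contradicts constancy of
     the path. *)
  have := path_id (pi / log_norm (e 0 k)) w.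
  rewrite /unitary_path /aut_fun /= (fcalc_eigen gL _ (Qe k)).
  rewrite /unitary_char divfK // cospi sinpi => /eqP.
  rewrite -[X in _ == X]scale1r -subr_eq0 -scalerBl scaler_eq0 (negbTE w0) orbF.
  by rewrite eq_complex /= -opprD oppr_eq0 (pnatr_eq0 _ 2).
have er : e 0 k = (complex.Re (e 0 k))%:C%C by rewrite RRe_real // gtr0_real.
move: ln0; rewrite /log_norm gtr0_norm // => /eqP.
rewrite ln_eq0; last by move: epos; rewrite er ltcR.
by move=> /eqP E; rewrite er E.
Qed.

End UnitaryPath.

Theorem theorem5p21 (R : realType) (V : VOA R) (V_simple : simple V)
  (ip : V -> V -> R[i])
  (ip_unitary : normalized_invariant_scalar_product ip)
  (theta : V -> V) (theta_PCT : is_PCT ip theta) :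
  [<-> forall ip' : V -> V -> R[i],
         normalized_invariant_scalar_product ip' -> ip' =2 ip;
       isometric_aut ip = [set: aut V];
       forall (g : aut V) (a : V), g (theta a) = theta (g a);
       compact [set: aut V];
       totally_disconnected (isometric_aut ip)].
Proof.
have [ipS _ _] := ip_unitary; tfae.
- exact: (unique_isometric ip_unitary theta_PCT).
- exact: (isometric_commute V_simple ip_unitary theta_PCT).
- move=> commute; apply: (isometric_compact ipS).
  exact: (commute_isometric V_simple ip_unitary theta_PCT commute).
- exact: (compact_totally_disconnected ipS).
- move=> td ip' ip'_unitary a b; have [ipS' _ _] := ip'_unitary.
  (* A second product is (g a | b), where g inherits self-adjointness and positivity from it; total
     disconnectedness forces g to be the identity. *)
  have [g gA gE] := positive_aut V_simple ip_unitary theta_PCT ip'_unitary.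
  rewrite gE (totally_disconnected_positive_aut ipS gA _ _ td) //.
    by move=> x y; rewrite -gE -(ip_conj ipS') gE (ip_conj ipS).
  by move=> x x0; rewrite -gE; have [_ _ /(_ x x0)] := ipS'.
Qed.
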